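(* Let $A\in\mathbb C^{4\times 4}$ be a reciprocal matrix with superdiagonal entries $b_j$ and subdiagonal entries $c_j=b_j^{-1}$, and let $A_j=\frac12(|b_j|^2+|c_j|^2)$ for $j=1,2,3$ (so $A_j\ge 1$). Let $\phi=\frac{\sqrt5+1}{2}$. Then the numerical range $W(A)$ is elliptical if and only if $$A_2=\phi A_1-\phi^{-1}A_3\quad\text{or}\quad A_2=\phi A_3-\phi^{-1}A_1,$$ and at least one of the inequalities $A_j\ge 1$ ($j=1,2,3$) is strict. Moreover, in this case the Kippenhahn curve $C(A)$ is the union of two nested axis-aligned ellipses centered at the origin.
   Context: The numerical range of $A\in\mathbb C^{n\times n}$ is $W(A)=\{\langle Ax,x\rangle:\ \|x\|=1\}$; it is called elliptical if it is a (non-degenerate) elliptical disk. A reciprocal matrix is a tridiagonal matrix $A\in\mathbb C^{n\times n}$ with zero main diagonal, superdiagonal entries $b_1,\dots,b_{n-1}$ and subdiagonal entries $c_1,\dots,c_{n-1}$ satisfying $b_jc_j=1$ for all $j$. Kippenhahn curve: write $\operatorname{Re}M=(M+M^* )/2$ and $P_A(\lambda,\theta)=\det(\operatorname{Re}(e^{i\theta}A)-\lambda I)$ (the NR generating polynomial). $C(A)$ is the class-$n$ algebraic curve in $\mathbb C\cong\mathbb R^2$ whose tangent lines are $\{e^{-i\theta}(\lambda_k(\theta)+it):t\in\mathbb R\}$, $k=1,\dots,n$, $\theta\in\mathbb R$, where $\lambda_1(\theta),\dots,\lambda_n(\theta)$ are the eigenvalues of $\operatorname{Re}(e^{i\theta}A)$;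 $W(A)$ is the convex hull of $C(A)$. Components of $C(A)$ (with multiplicity) correspond to factors of $P_A$: an ellipse centered at $w_0\in\mathbb C$ is a component when $P_A$ is divisible by $(\lambda-\operatorname{Re}(e^{i\theta}w_0))^2-(x\cos 2\theta+y\sin 2\theta+z)$ for the corresponding $x,y,z\in\mathbb R$ with $z\ge\sqrt{x^2+y^2}$, $z>0$; when $z=\sqrt{x^2+y^2}$ the ellipse is degenerate, namely the doubleton of its foci. Here the ellipses that are components of $C(A)$ are allowed to be degenerate in this sense (the outer one, bounding $W(A)$, is non-degenerate). *)

(* Defs.v *)
From HB Require Import structures.
From mathcomp Require Import all_boot all_order all_algebra.
From mathcomp Require Import complex.
From mathcomp Require Import boolp classical_sets reals normedtype derive trigo.

Set Implicit Arguments.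
Unset Strict Implicit.
Unset Printing Implicit Defensive.

Import Order.TTheory GRing.Theory Num.Theory.
Import numFieldNormedType.Exports.

Local Open Scope classical_set_scope.
Local Open Scope ring_scope.
Local Open Scope complex_scope.
Local Open Scope sesquilinear_scope.

Local Notation Re := complex.Re.
Local Notation Im := complex.Im.

Definition cmod {R : realType} (z : R[i]) : R := ComplexField.Normc.normc z.

Definition expi {R : realType} (t : R) : R[i] := cos t +i* sin t.

Definition inner {R : realType} {n : nat} (u v : 'cV[R[i]]_n) : R[i] :=
  (v^t* *m u) 0 0.

Definition vnorm {R : realType} {n : nat} (x : 'cV[R[i]]_n) : R :=
  Num.sqrt (\sum_i cmod (x i 0) ^+ 2).

Definition numerical_range {R : realType} {n : nat} (A : 'M[R[i]]_n) :
    set R[i] :=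
  [set w | exists2 x : 'cV[R[i]]_n, vnorm x = 1 & w = inner (A *m x) x].

Definition superdiag {R : realType} {n : nat} (A : 'M[R[i]]_n.+1) (j : 'I_n) :
    R[i] :=
  A (widen_ord (leqnSn n) j) (lift ord0 j).

Definition subdiag {R : realType} {n : nat} (A : 'M[R[i]]_n.+1) (j : 'I_n) :
    R[i] :=
  A (lift ord0 j) (widen_ord (leqnSn n) j).

Definition reciprocal {R : realType} {n : nat} (A : 'M[R[i]]_n.+1) : Prop :=
  (forall i j : 'I_n.+1, j != i.+1 :> nat -> i != j.+1 :> nat -> A i j = 0)
  /\ (forall j : 'I_n, superdiag A j * subdiag A j = 1).

Definition recip_mean {R : realType} {n : nat} (A : 'M[R[i]]_n.+1) (j : 'I_n) :
    R :=
  (cmod (superdiag A j) ^+ 2 + cmod (subdiag A j) ^+ 2) / 2.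

Definition golden (R : realType) : R := (Num.sqrt 5 + 1) / 2.

(* [major] is the full length of the major axis.  The case [|focus1 - focus2| = major]
   is the degenerate ellipse; circles ([focus1 = focus2]) are included. *)
Record ellipse (R : realType) := Ellipse {
  focus1 : R[i];
  focus2 : R[i];
  major : R;
  major_gt0 : 0 < major;
  focal_dist_le : cmod (focus1 - focus2) <= major
}.

Definition ellipse_nondegenerate {R : realType} (E : ellipse R) : Prop :=
  cmod (focus1 E - focus2 E) < major E.

Definition focal_sum {R : realType} (E : ellipse R) (w : R[i]) : R :=
  cmod (w - focus1 E) + cmod (w - focus2 E).

(* A degenerate ellipse is the doubleton of its foci, not the segment. *)
Definition ellipse_curve {R : realType} (E : ellipse R) : set R[i] :=
  [set w | (ellipse_nondegenerate E /\ focal_sum E w = major E)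
           \/ (~ ellipse_nondegenerate E /\ (w = focus1 E \/ w = focus2 E))].

Definition ellipse_disk {R : realType} (E : ellipse R) : set R[i] :=
  [set w | focal_sum E w <= major E].

Definition ellipse_interior {R : realType} (E : ellipse R) : set R[i] :=
  [set w | focal_sum E w < major E].

Definition elliptical {R : realType} (S : set R[i]) : Prop :=
  exists2 E : ellipse R, ellipse_nondegenerate E & S = ellipse_disk E.

Definition ellipse_center {R : realType} (E : ellipse R) : R[i] :=
  (focus1 E + focus2 E) / 2.

(* The focal axis is horizontal or vertical (any circle qualifies). *)
Definition axis_aligned {R : realType} (E : ellipse R) : Prop :=
  Im (focus1 E - focus2 E) = 0 \/ Re (focus1 E - focus2 E) = 0.

Definition nested_in {R : realType} (E1 E2 : ellipse R) : Prop :=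
  ellipse_disk E1 `<=` ellipse_interior E2.

(* With c the center, f the vector from c to a focus and a >= b the semi-axes, the
   line Re (expi theta * w) = lam touches the ellipse iff
     (lam - Re (expi theta * c)) ^ 2 = x cos(2 theta) + y sin(2 theta) + z
   where x - i y = f ^ 2 / 2 and z = (a ^ 2 + b ^ 2) / 2 = a ^ 2 - |f| ^ 2 / 2.
   Hence sqrt (x ^ 2 + y ^ 2) <= z, with equality iff b = 0. *)
Definition half_focal {R : realType} (E : ellipse R) : R[i] :=
  (focus1 E - focus2 E) / 2.

Definition ell_x {R : realType} (E : ellipse R) : R :=
  Re (half_focal E ^+ 2) / 2.

Definition ell_y {R : realType} (E : ellipse R) : R :=
  - Im (half_focal E ^+ 2) / 2.

Definition ell_z {R : realType} (E : ellipse R) : R :=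
  (major E / 2) ^+ 2 - cmod (half_focal E) ^+ 2 / 2.

Definition ellipse_factor {R : realType} (E : ellipse R) (lam theta : R) : R :=
  (lam - Re (expi theta * ellipse_center E)) ^+ 2
  - (ell_x E * cos (2 * theta) + ell_y E * sin (2 * theta) + ell_z E).

Definition re_part {R : realType} {n : nat} (M : 'M[R[i]]_n) : 'M[R[i]]_n :=
  2^-1 *: (M + M^t*).

Definition NR_poly {R : realType} {n : nat} (A : 'M[R[i]]_n) (lam theta : R) :
    R[i] :=
  \det (re_part (expi theta *: A) - (lam%:C)%:M).

(* Smooth selections theta |-> lam theta of eigenvalues of
   Re (expi theta * A); by Rellich's theorem n analytic ones give the whole
   spectrum, and any differentiable selection is tangent to one of these. *)
Definition eigen_branch {R : realType} {n : nat} (A : 'M[R[i]]_n)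
    (lam : R -> R) : Prop :=
  forall t : R, derivable lam t 1 /\ NR_poly A (lam t) t = 0.

(* The curve with tangent lines Re (expi theta * w) = lam theta, i.e. the
   envelope of these lines: differentiating in theta gives
   Im (expi theta * w) = - lam' theta, so that the line at theta touches the
   curve at w = expi (- theta) * (lam theta - i lam' theta).  If all the lines
   of a branch pass through one point, the branch contributes that point. *)
Definition kippenhahn_curve {R : realType} {n : nat} (A : 'M[R[i]]_n) :
    set R[i] :=
  [set w | exists2 lam : R -> R, eigen_branch A lam &
     exists theta : R,
       w = expi (- theta) * (lam theta -i* derive1 lam theta)].

(* The curve is made of the components [E1] and [E2], counted with
   multiplicity: their factors exhaust the NR generating polynomial, and
   their union is the curve. *)
Definition kippenhahn_union {R : realType} {n : nat} (A : 'M[R[i]]_n)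
    (E1 E2 : ellipse R) : Prop :=
  (forall lam theta : R,
     NR_poly A lam theta
     = (ellipse_factor E1 lam theta * ellipse_factor E2 lam theta)%:C)
  /\ kippenhahn_curve A = ellipse_curve E1 `|` ellipse_curve E2.

(* Main.v *)
Require Import Defs.
From mathcomp Require Import all_boot all_order all_algebra.
From mathcomp Require Import complex ring lra.
From mathcomp Require Import boolp classical_sets reals topology normedtype.
From mathcomp Require Import derive realfun trigo.
Import Order.TTheory GRing.Theory Num.Theory.
Import numFieldNormedType.Exports.
Local Open Scope ring_scope.
Local Open Scope complex_scope.
Local Open Scope sesquilinear_scope.

(** The matrix Re (z A) is Hermitian and tridiagonal with zero diagonal.  Since
    b_j c_j = 1, the squared moduli of its off-diagonal entries are
    xi_j = (|z|^2 A_j + Re (z^2)) / 2, where A_j is the mean of the squared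
    moduli of b_j and c_j ([cmod_re_entry]), and its characteristic polynomial
    is mu^2 - (xi_1 + xi_2 + xi_3) mu + xi_1 xi_3 in mu = lam^2
    ([det_tridiag]).  The support value of W(A) in direction z is the square
    root of the larger root mu(z) of this polynomial ([tridiag_support]).

    For an ellipse centered at the origin, the squared support value is a
    linear function x tau + y of tau = cos (2 theta), up to a term in
    sin (2 theta) that the symmetry of mu excludes here.  If W(A) is an
    ellipse, then x tau + y divides (tau + A_1) (tau + A_3) / 4, and the sum of
    the two complementary linear factors is (A_1 + A_2 + A_3 + 3 tau) / 2.
    Their leading coefficients have sum 3/2 and product 1/4, hence are phi^2 / 2
    and phi^-2 / 2, and the constant terms give the relation between the A_j
    ([golden_of_quadratic_factors], [golden_of_elliptical]).

    Conversely, the relation splits the polynomial into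
    lam^2 - phi^2 xi and lam^2 - phi^-2 xi', where xi and xi' are xi_1 and xi_3
    in some order.  These are the factors of two ellipses with foci phi, - phi
    and phi^-1, - phi^-1; the first is the larger one as soon as some A_j
    exceeds 1 ([golden_factors_gap]), so that W(A) and the outer ellipse have
    the same support values.  They are then equal because W(A) is convex
    ([numerical_range_convex], [numerical_range_axial]).

    For the curve, the strict inequality between the two factors forces a
    differentiable eigenvalue branch to satisfy, near each angle, the equation
    of one of the ellipses, and the contact point of its line is computed by
    differentiating that equation ([contact_on_ellipse]).  The inner ellipse
    may be a doubleton, which needs a separate limit argument where the branch
    vanishes ([width_branch_sqr_derive]). *)

Local Notation Re := complex.Re.
Local Notation Im := complex.Im.

Set Implicit Arguments.
Unset Strict Implicit.
Unset Printing Implicit Defensive.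

(** * Focal description of ellipses *)

Section PlaneEllipses.
Context {R : realType}.
Implicit Types (a f : R) (z w : R[i]).

Lemma cmodE z : cmod z = Num.sqrt (Re z ^+ 2 + Im z ^+ 2).
Proof. by case: z. Qed.

Lemma sqr_cmod z : cmod z ^+ 2 = Re z ^+ 2 + Im z ^+ 2.
Proof. by rewrite cmodE sqr_sqrtr // addr_ge0 ?sqr_ge0. Qed.

Lemma cmod_ge0 z : 0 <= cmod z.
Proof. by rewrite cmodE sqrtr_ge0. Qed.

Lemma cReM z w : Re (z * w) = Re z * Re w - Im z * Im w.
Proof. by case: z w => [? ?] [? ?]. Qed.

Lemma cImM z w : Im (z * w) = Re z * Im w + Im z * Re w.
Proof. by case: z w => [? ?] [? ?]. Qed.

Lemma cReD z w : Re (z + w) = Re z + Re w.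
Proof. by case: z w => [? ?] [? ?]. Qed.

Lemma cImD z w : Im (z + w) = Im z + Im w.
Proof. by case: z w => [? ?] [? ?]. Qed.

Lemma cReN z : Re (- z) = - Re z.
Proof. by case: z. Qed.

Lemma cImN z : Im (- z) = - Im z.
Proof. by case: z. Qed.

Definition complex_partsE := (cReM, cImM, cReD, cImD, cReN, cImN).

Lemma half_Re z : Re (z / 2) = Re z / 2.
Proof.
have -> : (2 : R[i])^-1 = (2^-1)%:C by rewrite fmorphV rmorph_nat.
by rewrite cReM /= mulr0 subr0.
Qed.

Lemma half_Im z : Im (z / 2) = Im z / 2.
Proof.
have -> : (2 : R[i])^-1 = (2^-1)%:C by rewrite fmorphV rmorph_nat.
by rewrite cImM /= mulr0 add0r.
Qed.

Lemma complex_ext z w : Re z = Re w -> Im z = Im w -> z = w.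
Proof. by case: z w => [? ?] [? ?] /= -> ->. Qed.

Lemma ler_sqr_nneg (x y : R) : 0 <= x -> 0 <= y -> (x <= y) = (x ^+ 2 <= y ^+ 2).
Proof. by move=> x0 y0; rewrite ler_pXn2r. Qed.

Lemma ltr_sqr_nneg (x y : R) : 0 <= x -> 0 <= y -> (x < y) = (x ^+ 2 < y ^+ 2).
Proof. by move=> x0 y0; rewrite ltr_pXn2r. Qed.

(** Squaring the focal equation |u - f| + |u + f| = 2 a twice removes the
    square roots and leaves this quadratic polynomial in [u]; it is negative
    inside the ellipse and positive outside. *)
Definition conic a (f u : R[i]) : R :=
  a ^+ 2 * (Re u ^+ 2 + Im u ^+ 2) - (Re u * Re f + Im u * Im f) ^+ 2
  - a ^+ 2 * (a ^+ 2 - (Re f ^+ 2 + Im f ^+ 2)).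

(** The two squarings.  The first one can be undone because both sides are
    nonnegative; the second one only when the quantity [k] is nonnegative,
    which is where a bound on [u] has to come in. *)
Lemma focal_sqr a (f u : R[i]) :
  let k := 2 * a ^+ 2 - (Re u ^+ 2 + Im u ^+ 2 + Re f ^+ 2 + Im f ^+ 2) in
  let p := cmod (u - f) * cmod (u + f) in
  (2 * a) ^+ 2 - (cmod (u - f) + cmod (u + f)) ^+ 2 = 2 * (k - p) /\
  k ^+ 2 - p ^+ 2 = - 4 * conic a f u.
Proof.
move=> k p.
have s2 := sqr_cmod (u - f); have t2 := sqr_cmod (u + f).
rewrite !complex_partsE in s2 t2; split.
  have -> : (cmod (u - f) + cmod (u + f)) ^+ 2 =
    cmod (u - f) ^+ 2 + cmod (u + f) ^+ 2 + 2 * p by rewrite /p; ring.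
  by rewrite s2 t2 /k; ring.
by rewrite /p exprMn s2 t2 /k /conic; ring.
Qed.

(** Also valid for degenerate ellipses: when |f| = a the conic only says that
    [u] is on the focal line, and the first inequality is what bounds [u]. *)
Lemma focal_le_conic a (f u : R[i]) : 0 < a ->
  cmod (u - f) + cmod (u + f) <= 2 * a ->
  Re u ^+ 2 + Im u ^+ 2 + Re f ^+ 2 + Im f ^+ 2 <= 2 * a ^+ 2 /\ conic a f u <= 0.
Proof.
move=> a0 h; have [e1 e2] := focal_sqr a f u.
have p0 : 0 <= cmod (u - f) * cmod (u + f) by rewrite mulr_ge0 ?cmod_ge0.
rewrite ler_sqr_nneg ?addr_ge0 ?cmod_ge0 // in h; last by lra.
set k := (2 * a ^+ 2 - _) in e1 e2; set p := (cmod _ * _) in e1 e2 p0.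
have kp : p <= k by lra.
split; first by rewrite /k in kp; lra.
have : p ^+ 2 <= k ^+ 2 by rewrite -ler_sqr_nneg //; lra.
lra.
Qed.

(** By Cauchy-Schwarz the conic dominates (|u|^2 - a^2) (a^2 - |f|^2). *)
Lemma conic_bound a (f u : R[i]) : Re f ^+ 2 + Im f ^+ 2 < a ^+ 2 ->
  conic a f u <= 0 -> 
  Re u ^+ 2 + Im u ^+ 2 <= a ^+ 2.
Proof.
rewrite /conic => nd h; set N := Re u ^+ 2 + Im u ^+ 2 in h *.
set F := Re f ^+ 2 + Im f ^+ 2 in h nd.
have cs : (Re u * Re f + Im u * Im f) ^+ 2 <= N * F.
  have -> : N * F = (Re u * Re f + Im u * Im f) ^+ 2
     + (Re u * Im f - Im u * Re f) ^+ 2 by rewrite /N /F; ring.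
  by rewrite lerDl sqr_ge0.
have d0 : 0 < a ^+ 2 - F by lra.
rewrite -(ler_pM2r d0); lra.
Qed.

Lemma focal_ltE a (f u : R[i]) : 0 < a -> Re f ^+ 2 + Im f ^+ 2 < a ^+ 2 ->
  (cmod (u - f) + cmod (u + f) < 2 * a) = (conic a f u < 0).
Proof.
move=> a0 nd; have [e1 e2] := focal_sqr a f u.
have p0 : 0 <= cmod (u - f) * cmod (u + f) by rewrite mulr_ge0 ?cmod_ge0.
rewrite [LHS]ltr_sqr_nneg ?addr_ge0 ?cmod_ge0 //; last by lra.
set k := (2 * a ^+ 2 - _) in e1 e2; set p := (cmod _ * _) in e1 e2 p0.
apply/idP/idP => h.
  have kp : p < k by lra.
  have : p ^+ 2 < k ^+ 2 by rewrite -ltr_sqr_nneg //; lra.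
  lra.
have := conic_bound nd (ltW h) => hb.
have k0 : 0 < k by rewrite /k; lra.
have : p ^+ 2 < k ^+ 2 by lra.
rewrite -ltr_sqr_nneg //; [lra|exact: ltW].
Qed.

Lemma focal_leE a (f u : R[i]) : 0 < a -> Re f ^+ 2 + Im f ^+ 2 < a ^+ 2 ->
  (cmod (u - f) + cmod (u + f) <= 2 * a) = (conic a f u <= 0).
Proof.
move=> a0 nd; apply/idP/idP => h; first by have [] := focal_le_conic a0 h.
have [e1 e2] := focal_sqr a f u.
have p0 : 0 <= cmod (u - f) * cmod (u + f) by rewrite mulr_ge0 ?cmod_ge0.
rewrite ler_sqr_nneg ?addr_ge0 ?cmod_ge0 //; last by lra.
set k := (2 * a ^+ 2 - _) in e1 e2; set p := (cmod _ * _) in e1 e2 p0.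
have := conic_bound nd h => hb.
have k0 : 0 < k by rewrite /k; lra.
have : p ^+ 2 <= k ^+ 2 by lra.
rewrite -ler_sqr_nneg //; [lra|exact: ltW].
Qed.

Lemma focal_eqE a (f u : R[i]) : 0 < a -> Re f ^+ 2 + Im f ^+ 2 < a ^+ 2 ->
  (cmod (u - f) + cmod (u + f) == 2 * a) = (conic a f u == 0).
Proof. by move=> a0 nd; rewrite !eq_le focal_leE // !leNgt focal_ltE. Qed.

End PlaneEllipses.

(** * Support values of ellipses *)

Section EllipseRecords.
Context {R : realType}.
Implicit Types (a f h : R) (z w : R[i]) (S : set R[i]) (E : ellipse R).

(** [h] is the maximum over [S] of the linear functional with coefficient [z].
    The coefficient is an arbitrary complex number, not only a unit one: both
    sides of all the identities below are homogeneous in [z], and no angle has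
    to be chosen. *)
Definition support_value S z h : Prop :=
  (forall w, S w -> Re (z * w) <= h) /\ exists2 w, S w & Re (z * w) = h.

Lemma support_value_uniq S z h1 h2 :
  support_value S z h1 -> support_value S z h2 -> h1 = h2.
Proof.
move=> [u1 [w1 S1 e1]] [u2 [w2 S2 e2]]; apply/eqP.
by rewrite eq_le -{1}e1 u2 // -e2 u1.
Qed.

(** The square of the support value of the ellipse with foci [f] and [- f] and
    major axis [2 * a].  For z = expi theta it is the quadratic term
    x cos (2 theta) + y sin (2 theta) + z of [ellipse_factor]. *)
Definition width2 a (f z : R[i]) : R :=
  a ^+ 2 * (Re z ^+ 2 + Im z ^+ 2) - Im (z * f) ^+ 2.

Lemma width2_gt0 a (f z : R[i]) :
  Re f ^+ 2 + Im f ^+ 2 < a ^+ 2 -> z != 0 -> 0 < width2 a f z.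
Proof.
move=> nd z0.
have n0 : 0 < Re z ^+ 2 + Im z ^+ 2.
  rewrite lt_def addr_ge0 ?sqr_ge0 // andbT.
  by move: z0; rewrite eq_complex paddr_eq0 ?sqr_ge0 // !sqrf_eq0.
have -> : width2 a f z = (a ^+ 2 - (Re f ^+ 2 + Im f ^+ 2)) *
    (Re z ^+ 2 + Im z ^+ 2) + Re (z * f) ^+ 2.
  by rewrite /width2 !complex_partsE; ring.
by rewrite ltr_wpDr ?sqr_ge0 // mulr_gt0 // subr_gt0.
Qed.

(** Cauchy-Schwarz for the positive definite form M = a^2 I - f f^T of the
    ellipse: with z' the conjugate of [z], <z', u>^2 is at most
    <z', M^-1 z'> <u, M u>, the difference being a square.  The determinant of
    M is the constant [D], and [width2] is <z', adj(M) z'>. *)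
Lemma conic_support_le a (f z u : R[i]) :
  0 < a -> Re f ^+ 2 + Im f ^+ 2 < a ^+ 2 -> z != 0 ->
  conic a f u <= 0 -> Re (z * u) <= Num.sqrt (width2 a f z).
Proof.
move=> a0 nd z0 hc.
have W0 := width2_gt0 nd z0.
apply: le_trans (ler_norm _) _; rewrite -sqrtr_sqr ler_wsqrtr //.
set D := a ^+ 2 * (a ^+ 2 - (Re f ^+ 2 + Im f ^+ 2)).
have D0 : 0 < D by rewrite mulr_gt0 ?exprn_gt0 // subr_gt0.
rewrite -(ler_pM2l D0).
pose s := Re u * Re f + Im u * Im f.
have e : width2 a f z * (conic a f u + D) - D * Re (z * u) ^+ 2 =
  (Re z * (a ^+ 2 * Im u - Im f * s) + Im z * (a ^+ 2 * Re u - Re f * s)) ^+ 2.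
  by rewrite /D /s /width2 /conic !complex_partsE; ring.
have : width2 a f z * (conic a f u + D) <= D * width2 a f z.
  rewrite mulrC ler_pM2r // -lerBrDr; lra.
have := sqr_ge0
  (Re z * (a ^+ 2 * Im u - Im f * s) + Im z * (a ^+ 2 * Re u - Re f * s)).
lra.
Qed.

(** Equality holds in Cauchy-Schwarz when [u] is proportional to adj(M) z'. *)
Lemma conic_support_attained a (f z : R[i]) :
  Re f ^+ 2 + Im f ^+ 2 < a ^+ 2 -> z != 0 ->
  exists2 u, conic a f u = 0 & Re (z * u) = Num.sqrt (width2 a f z).
Proof.
move=> nd z0.
have W0 := width2_gt0 nd z0.
set h := Num.sqrt (width2 a f z).
have h0 : h != 0 by rewrite gt_eqF // sqrtr_gt0.
have hW : h ^+ 2 = width2 a f z by rewrite sqr_sqrtr // ltW.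
pose u1 := (a ^+ 2 - Im f ^+ 2) * Re z - Re f * Im f * Im z.
pose u2 := Re f * Im f * Re z - (a ^+ 2 - Re f ^+ 2) * Im z.
exists ((u1 / h) +i* (u2 / h)).
  have e : conic a f ((u1 / h) +i* (u2 / h)) =
     (a ^+ 2 * (u1 ^+ 2 + u2 ^+ 2) - (u1 * Re f + u2 * Im f) ^+ 2
       - a ^+ 2 * (a ^+ 2 - (Re f ^+ 2 + Im f ^+ 2)) * h ^+ 2) / h ^+ 2.
    by rewrite /conic /=; field.
  rewrite e (_ : _ - _ = 0) ?mul0r // hW /u1 /u2 /width2 !complex_partsE; ring.
rewrite cReM /= (_ : _ - _ = h ^+ 2 / h); last first.
  by rewrite hW /u1 /u2 /width2 !complex_partsE; field.
by rewrite expr2 mulfK.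
Qed.

Lemma focal_sumE E w :
  focal_sum E w = cmod (w - ellipse_center E - half_focal E)
                + cmod (w - ellipse_center E + half_focal E).
Proof.
rewrite /focal_sum /ellipse_center /half_focal.
by congr (cmod _ + cmod _); apply: complex_ext;
  rewrite !(half_Re, half_Im, complex_partsE); field.
Qed.

Lemma half_focal_lt E : ellipse_nondegenerate E ->
  Re (half_focal E) ^+ 2 + Im (half_focal E) ^+ 2 < (major E / 2) ^+ 2.
Proof.
rewrite /ellipse_nondegenerate ltr_sqr_nneg ?cmod_ge0 ?(ltW (major_gt0 E)) //.
by rewrite sqr_cmod /half_focal half_Re half_Im; lra.
Qed.

Lemma ellipse_diskE E w : ellipse_nondegenerate E ->
  ellipse_disk E w = (conic (major E / 2) (half_focal E) (w - ellipse_center E) <= 0).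
Proof.
move=> nd; rewrite /ellipse_disk /= focal_sumE -focal_leE ?half_focal_lt //.
  by rewrite (_ : 2 * _ = major E) //; field.
by have := major_gt0 E; lra.
Qed.

Lemma ellipse_support E z : ellipse_nondegenerate E -> z != 0 ->
  support_value (ellipse_disk E) z (Re (z * ellipse_center E)
     + Num.sqrt (width2 (major E / 2) (half_focal E) z)).
Proof.
move=> nd z0; have lt := half_focal_lt nd.
have a0 : 0 < major E / 2 by have := major_gt0 E; lra.
split=> [w|].
  rewrite ellipse_diskE // => /(conic_support_le a0 lt z0).
  by rewrite mulrBr cReD cReN; lra.
have [u uc us] := conic_support_attained lt z0.
exists (ellipse_center E + u); last by rewrite mulrDr cReD us.
by rewrite ellipse_diskE // addrC addKr uc.
Qed.

Lemma axial_major_gt0 a : 0 < a -> 0 < 2 * a.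
Proof. by lra. Qed.

Lemma axial_focal_dist a f : 0 <= f <= a -> cmod (f%:C - (- f)%:C) <= 2 * a.
Proof.
move=> /andP[f0 fa]; rewrite cmodE !complex_partsE /= oppr0 addr0 expr0n addr0 sqrtr_sqr.
by rewrite opprK ger0_norm; lra.
Qed.

(** The ellipse with foci [f] and [- f] on the real axis, semi-major axis [a]
    and squared semi-minor axis [a ^+ 2 - f ^+ 2]. *)
Definition axial_ellipse a f (a0 : 0 < a) (fa : 0 <= f <= a) : ellipse R :=
  Ellipse (axial_major_gt0 a0) (axial_focal_dist fa).

Section Axial.
Variables (a f : R) (a0 : 0 < a) (fa : 0 <= f <= a).
Let E := axial_ellipse a0 fa.

Lemma axial_center : ellipse_center E = 0.
Proof. by apply: complex_ext; rewrite ?half_Re ?half_Im !complex_partsE /=; lra. Qed.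

Lemma axial_half_focal : half_focal E = f%:C.
Proof. by apply: complex_ext; rewrite ?half_Re ?half_Im !complex_partsE /=; lra. Qed.

Lemma axial_half_major : major E / 2 = a.
Proof. by rewrite /=; field. Qed.

Lemma axial_nondegenerate : ellipse_nondegenerate E <-> f < a.
Proof.
rewrite /ellipse_nondegenerate cmodE !complex_partsE /= oppr0 addr0 expr0n addr0.
have /andP[f0 _] := fa; rewrite sqrtr_sqr opprK ger0_norm; last by lra.
by split; lra.
Qed.

Lemma axial_axis_aligned : axis_aligned E.
Proof. by left; rewrite !complex_partsE /= subrr. Qed.

Lemma axial_factor lam t :
  ellipse_factor E lam t = lam ^+ 2 - (a ^+ 2 - f ^+ 2 * sin t ^+ 2).
Proof.
rewrite /ellipse_factor /ell_x /ell_y /ell_z axial_half_focal axial_half_major.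
rewrite axial_center mulr0 sqr_cmod [f%:C ^+ 2]expr2 !complex_partsE /=.
rewrite (_ : 2 * t = t *+ 2) ?cos_mulr2n ?cos2sin2; last by rewrite mulr_natl.
by rewrite -mulr_natl; field.
Qed.

Lemma axial_diskE w : f < a -> 
  ellipse_disk E w =
  ((a ^+ 2 - f ^+ 2) * Re w ^+ 2 + a ^+ 2 * Im w ^+ 2 <= a ^+ 2 * (a ^+ 2 - f ^+ 2)).
Proof.
move=> lt; rewrite ellipse_diskE; last exact/axial_nondegenerate.
rewrite axial_half_focal axial_half_major axial_center subr0 /conic /=.
congr is_true; rewrite -[RHS]subr_le0; congr (_ <= 0); ring.
Qed.

Lemma axial_curveE w : f < a -> 
  ellipse_curve E w <->
  ((a ^+ 2 - f ^+ 2) * Re w ^+ 2 + a ^+ 2 * Im w ^+ 2 = a ^+ 2 * (a ^+ 2 - f ^+ 2)).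
Proof.
move=> lt; have nd : ellipse_nondegenerate E by apply/axial_nondegenerate.
have -> : ellipse_curve E w <-> focal_sum E w = major E.
  by split=> [[[]|[]]|]//; left.
have h := half_focal_lt nd.
rewrite focal_sumE axial_half_focal axial_center subr0.
have e : conic a f%:C w = (a ^+ 2 - f ^+ 2) * Re w ^+ 2 + a ^+ 2 * Im w ^+ 2
  - a ^+ 2 * (a ^+ 2 - f ^+ 2) by rewrite /conic /=; ring.
have c := @focal_eqE R a f%:C w a0.
rewrite axial_half_focal axial_half_major in h.
split.
  by move=> /eqP; rewrite c // e subr_eq0 => /eqP.
by move=> /eqP; rewrite -subr_eq0 -e -c // => /eqP.
Qed.

End Axial.

(** It is enough to compare the semi-axes, but the inner ellipse may be
    degenerate, so that the argument cannot divide by its minor semi-axis. *)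
Lemma axial_nested (a f A F : R) (a0 : 0 < a) (fa : 0 <= f <= a) (A0 : 0 < A)
    (FA : 0 <= F <= A) :
  F < A -> a < A -> a ^+ 2 - f ^+ 2 < A ^+ 2 - F ^+ 2 ->
  nested_in (axial_ellipse a0 fa) (axial_ellipse A0 FA).
Proof.
move=> lt aA bB w.
have nd : ellipse_nondegenerate (axial_ellipse A0 FA) by apply/axial_nondegenerate.
rewrite /ellipse_disk /ellipse_interior /= !focal_sumE !axial_half_focal !axial_center.
rewrite subr0 => /(focal_le_conic a0) [] /=.
have := half_focal_lt nd; rewrite axial_half_focal axial_half_major => h.
rewrite focal_ltE // /conic /= => h1 h2.
set X := Re w ^+ 2 in h1 h2 *.
have [X0 Y0] : 0 <= X /\ 0 <= Im w ^+ 2 by rewrite !sqr_ge0.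
have -> : (Re w * F + Im w * 0) ^+ 2 = X * F ^+ 2 by rewrite /X; ring.
have E2 : (Re w * f + Im w * 0) ^+ 2 = X * f ^+ 2 by rewrite /X; ring.
rewrite E2 in h2; move: X X0 (Im w ^+ 2) Y0 h1 h2 {E2} => X X0 Y Y0 h1 h2.
have : a ^+ 2 < A ^+ 2 by rewrite -ltr_sqr_nneg // ltW.
have : f ^+ 2 <= a ^+ 2 by case/andP: (fa) => f0 fa'; rewrite -ler_sqr_nneg // ltW.
have : F ^+ 2 < A ^+ 2 by case/andP: (FA) => F0 FA'; rewrite -ltr_sqr_nneg // ltW.
have : 0 < a ^+ 2 by rewrite exprn_gt0.
move: (a ^+ 2) (A ^+ 2) (f ^+ 2) (F ^+ 2) bB h1 h2 => p P q Q bB h1 h2 p0 QP qp pP.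
have [qp'|pq] : q < p \/ p = q by case: ltgtP qp; auto.
  have b0 : 0 < p - q by lra.
  have Yb : Y <= p - q.
    rewrite -(ler_pM2l p0); have := mulr_ge0 (ltW b0) X0; lra.
  (* For a given [Y] the extreme [X] makes the outer conic an affine function of
     [Y] on [0, p - q]; the products are its values at both ends, weighted. *)
  have i1 : 0 <= (P - Q) * (P - p) * (p - q - Y) by rewrite !mulr_ge0; lra.
  have i2 : 0 <= P * Y * ((P - Q) - (p - q)) by rewrite !mulr_ge0; lra.
  have i3 : 0 <= (P - Q) * (p * (p - q) - p * Y - (p - q) * X).
     by rewrite mulr_ge0; lra.
  rewrite -(pmulr_rlt0 _ b0).
  have [Y1|Y1] := ltP Y (p - q).
    have : 0 < (P - Q) * (P - p) * (p - q - Y) by rewrite !mulr_gt0; lra.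
    lra.
  have : 0 < P * Y * ((P - Q) - (p - q)) by rewrite !mulr_gt0; lra.
  lra.
have Y00 : Y = 0.
  apply/eqP; rewrite eq_le Y0 andbT -(ler_pM2l p0) mulr0; subst; lra.
subst q Y; have : 0 < (P - Q) * (P - X) by rewrite mulr_gt0; lra.
lra.
Qed.

End EllipseRecords.

(** * Numerical ranges *)

Lemma adj_mulmx {C : numClosedFieldType} m n p (A : 'M[C]_(m, n)) (B : 'M_(n, p)) :
  (A *m B)^t* = B^t* *m A^t*.
Proof. by rewrite trmx_mul map_mxM. Qed.

Section NumericalRange.
Context {R : realType} {n : nat}.
Implicit Types (A B : 'M[R[i]]_n) (x y u v : 'cV[R[i]]_n) (z w : R[i]).

Lemma conjC_conjc z : Num.conj z = conjc z.
Proof. by []. Qed.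

Lemma cReJ z : Re (Num.conj z) = Re z.
Proof. by rewrite conjC_conjc; case: z. Qed.

Lemma cImJ z : Im (Num.conj z) = - Im z.
Proof. by rewrite conjC_conjc; case: z. Qed.

Lemma innerE u v : inner u v = \sum_i Num.conj (v i 0) * u i 0.
Proof. by rewrite /inner !mxE; apply: eq_bigr => i _; rewrite !mxE. Qed.

Lemma innerDl u1 u2 v : inner (u1 + u2) v = inner u1 v + inner u2 v.
Proof. by rewrite /inner mulmxDr mxE. Qed.

Lemma innerZl z u v : inner (z *: u) v = z * inner u v.
Proof. by rewrite /inner -scalemxAr mxE. Qed.

Lemma innerJ u v : inner u v = Num.conj (inner v u).
Proof.
rewrite !innerE rmorph_sum; apply: eq_bigr => i _.
by rewrite rmorphM /= conjCK mulrC.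
Qed.

Lemma innerDr u v1 v2 : inner u (v1 + v2) = inner u v1 + inner u v2.
Proof. by rewrite innerJ innerDl rmorphD /= -!innerJ. Qed.

Lemma innerZr z u v : inner u (z *: v) = Num.conj z * inner u v.
Proof. by rewrite innerJ innerZl rmorphM /= -innerJ. Qed.

Lemma inner_adj A u v : inner (A *m u) v = inner u (A^t* *m v).
Proof. by rewrite /inner adj_mulmx trmxCK mulmxA. Qed.

Lemma inner_self u : inner u u = (vnorm u ^+ 2)%:C.
Proof.
rewrite /vnorm sqr_sqrtr ?sumr_ge0 // => [|i _]; last exact: sqr_ge0.
rewrite innerE rmorph_sum; apply: eq_bigr => i _ /=.
rewrite sqr_cmod; apply: complex_ext.
  by rewrite cReM cReJ cImJ /=; ring.
by rewrite cImM cReJ cImJ /=; ring.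
Qed.

Lemma vnorm_eq0 u : vnorm u = 0 -> u = 0.
Proof.
move/eqP; rewrite /vnorm sqrtr_eq0 => h.
apply/colP => i; rewrite mxE.
have p (j : 'I_n) : true -> 0 <= cmod (u j 0) ^+ 2 by rewrite sqr_ge0.
have /eqP : \sum_j cmod (u j 0) ^+ 2 = 0.
  by apply/eqP; rewrite eq_le h sumr_ge0.
rewrite psumr_eq0 // => /allP/(_ i); rewrite mem_index_enum sqrf_eq0 => /(_ isT).
by move=> /eqP /ComplexField.Normc.eq0_normc.
Qed.

(** Any nonzero vector can be used instead of a unit one, provided that the
    value is divided by its squared norm. *)
Lemma numerical_range_homogeneous A x w :
  x != 0 -> inner (A *m x) x = w * inner x x -> numerical_range A w.
Proof.
move=> x0 e; set r := vnorm x.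
have r0 : r != 0 by apply: contra_neq x0 => /vnorm_eq0.
have rC : r%:C != 0 by rewrite (inj_eq (@complexI _)).
have conjr : Num.conj (r%:C)^-1 = (r%:C)^-1 by rewrite fmorphV /= conjC_conjc conjc_real.
have rr : inner ((r%:C)^-1 *: x) ((r%:C)^-1 *: x) = 1.
  by rewrite innerZl innerZr inner_self rmorphXn /= conjr; field.
exists ((r%:C)^-1 *: x).
  have : vnorm ((r%:C)^-1 *: x) ^+ 2 = 1.
    by apply: (@complexI R); rewrite -inner_self rr.
  move/eqP; rewrite sqrf_eq1 => /orP[/eqP //|/eqP e1].
  by have := sqrtr_ge0 (\sum_i cmod (((r%:C)^-1 *: x) i 0) ^+ 2);
    rewrite -/(vnorm _) e1 lerNr oppr0 ler10.
transitivity (w * inner ((r%:C)^-1 *: x) ((r%:C)^-1 *: x)).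
  by rewrite rr mulr1.
by rewrite -scalemxAr !innerZl !innerZr e; ring.
Qed.

(** The Toeplitz-Hausdorff theorem.  For w on the segment, an affine change of
    [A] into [B] reduces the claim to finding a nonzero isotropic vector of
    [B], knowing that its form is the negative number [- t] at [x] and the
    positive number [1 - t] at [y].  Along x + c y the phase of [c] can be
    chosen so that the form is real, and then a real quadratic polynomial in
    the modulus of [c], with roots of opposite signs, has to vanish. *)
Lemma numerical_range_convex A w1 w2 (t : R) :
  numerical_range A w1 -> numerical_range A w2 -> 0 <= t <= 1 ->
  numerical_range A ((1 - t)%:C * w1 + t%:C * w2).
Proof.
move=> W1 W2 t01.
have [->|w12] := eqVneq w1 w2; first by rewrite -mulrDl -rmorphD subrK mul1r.
have [->|t0] := eqVneq t 0; first by rewrite subr0 mul1r mul0r addr0.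
have [->|t1] := eqVneq t 1; first by rewrite subrr mul0r mul1r add0r.
have [s0 s1] : 0 < t /\ 0 < 1 - t.
  by case/andP: t01 => ta tb; rewrite subr_gt0 !lt_def t0 (eq_sym 1) t1 ta tb.
set w := (_ + _); have d0 : w2 - w1 != 0 by rewrite subr_eq0 eq_sym.
have [x x1 ex] := W1; have [y y1 ey] := W2.
pose B := (w2 - w1)^-1 *: (A - w%:M).
have BE u v : inner (B *m u) v = (w2 - w1)^-1 * (inner (A *m u) v - w * inner u v).
  by rewrite /B -scalemxAl innerZl mulmxBl mul_scalar_mx -scaleNr innerDl innerZl mulNr.
have xx : inner x x = 1 by rewrite inner_self x1 expr1n.
have yy : inner y y = 1 by rewrite inner_self y1 expr1n.
have bx : inner (B *m x) x = (- t)%:C.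
  rewrite BE -ex xx /w rmorphB rmorphN /=; rewrite rmorph1; field; exact: d0.
have yB : inner (B *m y) y = (1 - t)%:C.
  rewrite BE -ey yy /w rmorphB /=; rewrite rmorph1; field; exact: d0.
set p := inner (B *m x) y; set q := inner (B *m y) x.
(* The form at x + c y is real as soon as the cross term is, and its imaginary
   part is that of c (q - conj p). *)
pose c0 : R[i] := if q - Num.conj p == 0 then 1 else Num.conj (q - Num.conj p).
have c00 : c0 != 0.
  by rewrite /c0; case: ifP => [_|/negbT];
  rewrite ?oner_neq0 // conjC_eq0.
have imc : Im (Num.conj c0 * p + c0 * q) = 0.
  have -> : Im (Num.conj c0 * p + c0 * q) = Im (c0 * (q - Num.conj p)).
    by rewrite cImD !cImM !complex_partsE !cReJ !cImJ; ring.
  rewrite /c0; case: ifP => [/eqP ->|_]; first by rewrite mulr0.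
  by rewrite cImM cReJ cImJ; ring.
pose be := Re (Num.conj c0 * p + c0 * q).
have beE : Num.conj c0 * p + c0 * q = be%:C by apply: complex_ext.
pose r := cmod c0 ^+ 2 * (1 - t).
have cc0 : 0 < cmod c0 ^+ 2.
  by rewrite exprn_gt0 // lt_def cmod_ge0 andbT;
    apply: contra_neq c00 => /ComplexField.Normc.eq0_normc.
have r0 : 0 < r by rewrite mulr_gt0.
pose D := be ^+ 2 + 4 * t * r.
have D0 : 0 <= D by rewrite addr_ge0 ?sqr_ge0 // mulr_ge0; lra.
pose tau := (Num.sqrt D - be) / (2 * r).
have tauE : - t + tau * be + tau ^+ 2 * r = 0.
  have -> : - t + tau * be + tau ^+ 2 * r = (Num.sqrt D ^+ 2 - D) / (4 * r).
    by rewrite /tau /D; field; rewrite gt_eqF.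
  by rewrite sqr_sqrtr // subrr mul0r.
pose c := tau%:C * c0.
have cJ : Num.conj c = tau%:C * Num.conj c0.
  by rewrite /c rmorphM /= [Num.conj tau%:C]conjC_conjc conjc_real.
have ccE : c * Num.conj c = (tau ^+ 2 * cmod c0 ^+ 2)%:C.
  rewrite cJ /c sqr_cmod; apply: complex_ext; rewrite !complex_partsE !cReJ !cImJ /=; ring.
apply: (@numerical_range_homogeneous _ (x + c *: y)).
  (* If x = - c y, the forms at [x] and at [y] would have the same sign. *)
  apply/eqP => /eqP; rewrite addr_eq0 => /eqP xE.
  have : (- t)%:C = (tau ^+ 2 * cmod c0 ^+ 2 * (1 - t))%:C.
    rewrite -bx xE -scaleNr -scalemxAr innerZl innerZr yB [Num.conj _]rmorphN /=.
    by rewrite [RHS]rmorphM /= -ccE; ring.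
  move/(@complexI R) => e.
  have : 0 <= tau ^+ 2 * cmod c0 ^+ 2 * (1 - t).
    by apply: mulr_ge0; [rewrite mulr_ge0 ?sqr_ge0 | exact: ltW].
  by rewrite -e oppr_ge0 leNgt s0.
apply/eqP; rewrite -subr_eq0.
suff : inner (B *m (x + c *: y)) (x + c *: y) = 0.
  by rewrite BE => /eqP; rewrite mulf_eq0 invr_eq0 (negbTE d0).
rewrite mulmxDr -scalemxAr !innerDl !innerDr !innerZl !innerZr bx yB -/p -/q.
have -> : (- t)%:C + Num.conj c * p + (c * q + c * (Num.conj c * (1 - t)%:C)) =
   (- t)%:C + tau%:C * (Num.conj c0 * p + c0 * q) + (c * Num.conj c) * (1 - t)%:C.
  by rewrite cJ /c; ring.
rewrite beE ccE -!rmorphM -!rmorphD /=.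
by rewrite (_ : _ + _ = 0) // -tauE /r; ring.
Qed.

Lemma Re_quadratic_form A x : Re (inner (A *m x) x) = Re (inner (re_part A *m x) x).
Proof.
have -> : inner (re_part A *m x) x =
    (inner (A *m x) x + Num.conj (inner (A *m x) x)) / 2.
  rewrite /re_part -scalemxAl innerZl mulmxDl innerDl mulrC; congr (_ / _).
  by congr (_ + _); rewrite -innerJ inner_adj trmxCK.
by rewrite half_Re cReD cReJ; field.
Qed.

Lemma re_part_adj A : (re_part A)^t* = re_part A.
Proof.
apply/matrixP => i j; rewrite !mxE !(rmorphM, rmorphD) /= conjCK fmorphV rmorph_nat.
by rewrite addrC.
Qed.

(** An eigenvector of Re A for [lam] gives a point of the numerical range on
    the line Re w = lam.  The determinant criterion provides a left
    eigenvector, hence the adjoints. *)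
Lemma re_part_eigen_attained A (lam : R) :
  \det (re_part A - (lam%:C)%:M) = 0 ->
  exists2 w, numerical_range A w & Re w = lam.
Proof.
move/eqP/det0P => [v v0 ve].
pose x := v^t*.
have x0 : x != 0.
  by apply: contra_neq v0 => h; rewrite -[v]trmxCK -/x h;
    apply/matrixP=> i j; rewrite !mxE rmorph0.
have nx0 : inner x x != 0.
  rewrite inner_self (inj_eq (@complexI R)) sqrf_eq0.
  by apply: contra_neq x0 => /vnorm_eq0.
exists (inner (A *m x) x / inner x x).
  by apply: numerical_range_homogeneous x0 _; rewrite divfK.
have Hx : re_part A *m x = (lam%:C) *: x.
  apply/eqP; rewrite -subr_eq0 -mul_scalar_mx -mulmxBl.
  have -> : (re_part A - lam%:C%:M) *m x = (v *m (re_part A - lam%:C%:M))^t*.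
    rewrite adj_mulmx; congr (_ *m _).
    apply/matrixP => i j; rewrite -{1}re_part_adj !mxE rmorphB rmorphMn /=.
    by rewrite [Num.conj lam%:C]conjC_conjc conjc_real eq_sym.
  by rewrite ve; apply/eqP/matrixP => i j; rewrite !mxE rmorph0.
have e := Re_quadratic_form A x; rewrite Hx innerZl inner_self in e *.
have r0 : vnorm x != 0 by apply: contra_neq x0 => /vnorm_eq0.
rewrite -fmorphV cReM e /=. field; exact: r0.
Qed.

End NumericalRange.

(** * Tridiagonal and reciprocal matrices *)

Definition tridiag {K : nzRingType} (b c : nat -> K) : 'M[K]_4 :=
  \matrix_(i < 4, j < 4)
    if j == i.+1 :> nat then b i else if i == j.+1 :> nat then c j else 0.

(** Matrices are described here by entry functions on [nat], so that the
    recursive expansion below computes without handling ordinals. *)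
Definition first_row_minor {K : Type} (g : nat -> nat -> K) (j i k : nat) : K :=
  g i.+1 (bump j k).

Lemma det_expand_first_row (K : comNzRingType) n (g : nat -> nat -> K) :
  \det (\matrix_(i < n.+1, j < n.+1) g i j) =
  \sum_(j < n.+1) g 0%N j * ((-1) ^+ j *
     \det (\matrix_(i < n, k < n) first_row_minor g j i k)).
Proof.
rewrite (expand_det_row _ ord0); apply: eq_bigr => j _; rewrite mxE.
congr (_ * (_ * \det _)).
by apply/matrixP => i k; rewrite !mxE.
Qed.

Lemma det_tridiag (K : comNzRingType) (b c : nat -> K) (lam : K) :
  \det (tridiag b c - lam%:M) =
  lam ^+ 4 - (b 0%N * c 0%N + b 1%N * c 1%N + b 2 * c 2) * lam ^+ 2
  + (b 0%N * c 0%N) * (b 2 * c 2).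
Proof.
pose g (i j : nat) : K :=
  if j == i.+1 then b i else if i == j.+1 then c j else if i == j then - lam else 0.
have -> : tridiag b c - lam%:M = \matrix_(i < 4, j < 4) g i j.
  apply/matrixP => i j; rewrite !mxE /g -val_eqE /=.
  case: (ltngtP i j) => [h|h|->].
  - by rewrite [X in _ - X]mulr0n subr0 (ltn_eqF (leqW h)).
  - by rewrite [X in _ - X]mulr0n subr0.
  by rewrite ltn_eqF // mulr1n sub0r.
do 4 rewrite ?det_expand_first_row !big_ord_recl !big_ord0 /= !mul0r.
rewrite !det_mx00.
rewrite /first_row_minor {}/g /=. 
ring.
Qed.

(** The largest eigenvalue of a Jacobi matrix with zero diagonal bounds its
    quadratic form.  The two hypotheses say that [L ^+ 2] is the larger root of
    mu^2 - (k1^2 + k2^2 + k3^2) mu + k1^2 k3^2.  Completing squares in [r1] and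
    [r4] leaves a binary form in [r2] and [r3], whose discriminant vanishes by
    the equation for [L]. *)
Lemma continuant_form_le (R : realDomainType) (k1 k2 k3 L r1 r2 r3 r4 : R) :
  0 <= L -> L ^+ 4 - (k1 ^+ 2 + k2 ^+ 2 + k3 ^+ 2) * L ^+ 2 + k1 ^+ 2 * k3 ^+ 2 = 0 ->
  k1 ^+ 2 + k2 ^+ 2 + k3 ^+ 2 <= 2 * L ^+ 2 ->
  2 * (k1 * r1 * r2 + k2 * r2 * r3 + k3 * r3 * r4)
    <= L * (r1 ^+ 2 + r2 ^+ 2 + r3 ^+ 2 + r4 ^+ 2).
Proof.
move=> L0 root big.
have [p1 p2 p3] : [/\ 0 <= k1 ^+ 2, 0 <= k2 ^+ 2 & 0 <= k3 ^+ 2] by rewrite !sqr_ge0.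
have [Le|Ln0] := eqVneq L 0.
  rewrite Le in big *.
  have [/eqP e1 /eqP e2 /eqP e3] : [/\ k1 ^+ 2 == 0, k2 ^+ 2 == 0 & k3 ^+ 2 == 0].
    by rewrite !eq_le p1 p2 p3 !andbT; split; lra.
  move/eqP: e1; move/eqP: e2; move/eqP: e3; rewrite !sqrf_eq0.
  by move=> /eqP-> /eqP-> /eqP->; rewrite !mul0r !addr0 mulr0.
have Lp : 0 < L by rewrite lt_def Ln0.
pose al := L ^+ 2 - k1 ^+ 2; pose ga := L ^+ 2 - k3 ^+ 2.
have disc : al * ga = (L * k2) ^+ 2.
  by apply/eqP; rewrite -subr_eq0 -[X in _ == X]root /al /ga; apply/eqP; ring.
have s0 : 0 <= al + ga by rewrite /al /ga; lra.
have pr : 0 <= al * ga by rewrite disc sqr_ge0.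
have [al0 ga0] : 0 <= al /\ 0 <= ga.
  case: (ltP al 0) => ha; case: (ltP ga 0) => hg; split=> //; nra.
have mid : 0 <= al * r2 ^+ 2 - 2 * (L * k2) * r2 * r3 + ga * r3 ^+ 2.
  have [e|n0] := eqVneq al 0.
    have := disc; rewrite e mul0r => /esym/eqP; rewrite sqrf_eq0 => /eqP ->.
    by rewrite mul0r mulr0 mul0r mul0r subrr add0r mulr_ge0 ?sqr_ge0.
  have ap : 0 < al by rewrite lt_def n0.
  rewrite -(pmulr_rge0 _ ap).
  have -> : al * (al * r2 ^+ 2 - 2 * (L * k2) * r2 * r3 + ga * r3 ^+ 2) =
    (al * r2 - L * k2 * r3) ^+ 2 + (al * ga - (L * k2) ^+ 2) * r3 ^+ 2 by ring.
  by rewrite disc subrr mul0r addr0 sqr_ge0.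
rewrite -subr_ge0 -(pmulr_rge0 _ Lp).
have -> : L * (L * (r1 ^+ 2 + r2 ^+ 2 + r3 ^+ 2 + r4 ^+ 2)
     - 2 * (k1 * r1 * r2 + k2 * r2 * r3 + k3 * r3 * r4)) =
  (L * r1 - k1 * r2) ^+ 2 + (L * r4 - k3 * r3) ^+ 2
  + (al * r2 ^+ 2 - 2 * (L * k2) * r2 * r3 + ga * r3 ^+ 2).
  by rewrite /al /ga; ring.
by apply: addr_ge0 => //; apply: addr_ge0; exact: sqr_ge0.
Qed.

Section Reciprocal.
Context {R : realType}.
Implicit Types (A : 'M[R[i]]_4) (b c h : nat -> R[i]) (z w : R[i]).

Lemma cmodM z w : cmod (z * w) = cmod z * cmod w.
Proof. exact: ComplexField.Normc.normcM. Qed.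

Lemma cmodJ z : cmod (Num.conj z) = cmod z.
Proof. by rewrite !cmodE cReJ cImJ sqrrN. Qed.

Lemma Re_le_cmod z : Re z <= cmod z.
Proof.
apply: le_trans (ler_norm _) _.
by rewrite cmodE -sqrtr_sqr ler_wsqrtr // lerDl sqr_ge0.
Qed.

Lemma reciprocal_tridiag A : reciprocal A ->
  exists b c, [/\ A = tridiag b c, forall j, (j < 3)%N -> b j * c j = 1 &
    forall j, (j < 3)%N ->
      recip_mean A (inord j) = (cmod (b j) ^+ 2 + cmod (c j) ^+ 2) / 2].
Proof.
move=> [A0 A1].
pose b j := A (inord j) (inord j.+1); pose c j := A (inord j.+1) (inord j).
have supE j : (j < 3)%N -> superdiag A (inord j) = b j.
  move=> j3; rewrite /superdiag /b; congr (A _ _); apply: val_inj => /=.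
    by rewrite !inordK // ltnW.
  by rewrite /bump /= add1n !inordK.
have subE j : (j < 3)%N -> subdiag A (inord j) = c j.
  move=> j3; rewrite /subdiag /c; congr (A _ _); apply: val_inj => /=.
    by rewrite /bump /= add1n !inordK.
  by rewrite !inordK // ltnW.
exists b, c; split=> [|j j3|j j3].
- apply/matrixP => i j; rewrite mxE; case: eqP => [ji|/eqP nji].
    by rewrite /b -ji !inord_val.
  case: eqP => [ij|/eqP nij]; first by rewrite /c -ij !inord_val.
  exact: A0.
- by rewrite -supE // -subE // A1.
by rewrite /recip_mean supE // subE.
Qed.

(** Multiplying [A] by [z] and taking the real part keeps the tridiagonal
    shape, so that the numerical range in direction [z] is governed by the
    moduli of the entries [h j] only. *)
Lemma re_part_tridiag b c z :
  let h j := (z * b j + Num.conj (z * c j)) / 2 in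
  re_part (z *: tridiag b c) = tridiag h (fun j => Num.conj (h j)).
Proof.
move=> h; apply/matrixP => i j; rewrite !mxE /h.
have [->|ji] := eqVneq (j : nat) i.+1.
  rewrite (ltn_eqF (leqW (leqnn i.+1))) ?eqxx.
  by rewrite mulrC.
have [_|ij] := eqVneq (i : nat) j.+1.
  rewrite [RHS]fmorph_div rmorphD /= !conjCK rmorph_nat.
  by rewrite mulrC addrC.
by rewrite !mulr0 conjC0 addr0 mulr0.
Qed.

Lemma tridiag_form_le h (x : 'cV[R[i]]_4) (r := fun j => cmod (x (inord j) 0)) :
  Re (inner (tridiag h (fun j => Num.conj (h j)) *m x) x) <=
    2 * (cmod (h 0%N) * r 0%N * r 1%N + cmod (h 1%N) * r 1%N * r 2
         + cmod (h 2) * r 2 * r 3).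
Proof.
pose t j := h j * Num.conj (x (inord j) 0) * x (inord j.+1) 0.
have -> : inner (tridiag h (fun j => Num.conj (h j)) *m x) x =
  (t 0%N + Num.conj (t 0%N)) + (t 1%N + Num.conj (t 1%N)) + (t 2 + Num.conj (t 2)).
  have E (i : 'I_4) : x i 0 = x (inord i) 0 by rewrite inord_val.
  rewrite innerE; under eq_bigr => i _ do rewrite mxE E.
  under eq_bigr => i _ do under eq_bigr => j _ do rewrite mxE (E j).
  rewrite !big_ord_recl !big_ord0 /= /bump /= ?add1n ?addn0 /t !rmorphM /= !conjCK.
  ring.
have tle j : (t j + Num.conj (t j)) = (2 * Re (t j))%:C.
  by move: (t j) => s; apply: complex_ext; rewrite !complex_partsE ?cReJ ?cImJ /=; ring.
rewrite !tle -!rmorphD /=.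
have tb j : Re (t j) <= cmod (h j) * r j * r j.+1.
  by apply: le_trans (Re_le_cmod _) _; rewrite /t !cmodM cmodJ.
have := tb 0%N; have := tb 1%N; have := tb 2; lra.
Qed.

(** The squared modulus of an off-diagonal entry of Re (z A), when [a] is the
    mean of the squared moduli of the two corresponding entries of [A]; for
    z = expi theta it is (a + cos (2 theta)) / 2. *)
Definition entry_sqr (a : R) z : R :=
  ((Re z ^+ 2 + Im z ^+ 2) * a + (Re z ^+ 2 - Im z ^+ 2)) / 2.

(** The cross term of the square is Re (z^2 p q) = Re (z^2): reciprocity makes
    it independent of the arguments of [p] and [q]. *)
Lemma cmod_re_entry (p q z : R[i]) : p * q = 1 ->
  cmod ((z * p + Num.conj (z * q)) / 2) ^+ 2 =
  entry_sqr ((cmod p ^+ 2 + cmod q ^+ 2) / 2) z.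
Proof.
move=> pq.
have e1 : Re p * Re q - Im p * Im q = 1 by rewrite -cReM pq.
have e2 : Re p * Im q + Im p * Re q = 0 by rewrite -cImM pq.
rewrite /entry_sqr !sqr_cmod half_Re half_Im !(cReD, cImD) cReJ cImJ !(cReM, cImM).
have -> : ((Re z * Re p - Im z * Im p + (Re z * Re q - Im z * Im q)) / 2) ^+ 2 +
  ((Re z * Im p + Im z * Re p - (Re z * Im q + Im z * Re q)) / 2) ^+ 2 =
  ((Re z ^+ 2 + Im z ^+ 2) * ((Re p ^+ 2 + Im p ^+ 2 + (Re q ^+ 2 + Im q ^+ 2)) / 2)
   + (Re z ^+ 2 - Im z ^+ 2) * (Re p * Re q - Im p * Im q)
   - 2 * Re z * Im z * (Re p * Im q + Im p * Re q)) / 2 by field.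
by rewrite e1 e2 mulr1 mulr0 subr0.
Qed.

Section Support.
Variables (b c : nat -> R[i]) (a : nat -> R).
Hypothesis bc1 : forall j, (j < 3)%N -> b j * c j = 1.
Hypothesis aE : forall j, (j < 3)%N -> a j = (cmod (b j) ^+ 2 + cmod (c j) ^+ 2) / 2.
Variable z : R[i].
Let A := tridiag b c.
Let S := entry_sqr (a 0%N) z + entry_sqr (a 1%N) z + entry_sqr (a 2) z.
Let h j := (z * b j + Num.conj (z * c j)) / 2.

Let h_sqr j : (j < 3)%N -> cmod (h j) ^+ 2 = entry_sqr (a j) z.
Proof. by move=> j3; rewrite /h cmod_re_entry ?bc1 // aE. Qed.

Lemma entry_sqr_ge0 j : (j < 3)%N -> 0 <= entry_sqr (a j) z.
Proof. by move=> j3; rewrite -h_sqr // sqr_ge0. Qed.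

Lemma recip_mean_ge1 j : (j < 3)%N -> 1 <= a j.
Proof.
move=> j3; have := bc1 j3 => /(congr1 cmod).
rewrite cmodM [RHS]ComplexField.Normc.normc1 => e; rewrite aE //.
have := sqr_ge0 (cmod (b j) - cmod (c j)); rewrite sqrrB e; lra.
Qed.

Lemma NR_det_tridiag (lam : R) :
  \det (re_part (z *: A) - lam%:C%:M) =
  (lam ^+ 4 - S * lam ^+ 2 + entry_sqr (a 0%N) z * entry_sqr (a 2) z)%:C.
Proof.
rewrite re_part_tridiag -/h det_tridiag.
have hh j : (j < 3)%N -> h j * Num.conj (h j) = (entry_sqr (a j) z)%:C.
  move=> j3; rewrite -h_sqr // sqr_cmod.
  by move: (h j) => s; apply: complex_ext; rewrite !complex_partsE ?cReJ ?cImJ /=; ring.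
by rewrite !hh // /S -!rmorphXn -!rmorphD -!rmorphM -rmorphB -rmorphD.
Qed.

(** The support value is the square root of the larger root [mu] of the
    biquadratic characteristic polynomial: [continuant_form_le] gives the upper
    bound and an eigenvector attains it.  The second hypothesis selects the
    larger root. *)
Lemma tridiag_support (mu : R) :
  mu ^+ 2 - S * mu + entry_sqr (a 0%N) z * entry_sqr (a 2) z = 0 -> S <= 2 * mu ->
  support_value (numerical_range A) z (Num.sqrt mu).
Proof.
move=> root big.
have mu0 : 0 <= mu.
  by have := entry_sqr_ge0 (isT : 0 < 3)%N; have := entry_sqr_ge0 (isT : 1 < 3)%N;
     have := entry_sqr_ge0 (isT : 2 < 3)%N; rewrite /S in big; lra.
have s2 : Num.sqrt mu ^+ 2 = mu by rewrite sqr_sqrtr.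
have s4 : Num.sqrt mu ^+ 4 = mu ^+ 2 by rewrite (exprM _ 2 2) s2.
have zA x : z * inner (A *m x) x = inner ((z *: A) *m x) x.
  by rewrite -scalemxAl innerZl.
split.
  move=> _ [x x1 ->]; rewrite zA Re_quadratic_form re_part_tridiag -/h.
  apply: le_trans (tridiag_form_le _ _) _.
  have n1 : cmod (x (inord 0) 0) ^+ 2 + cmod (x (inord 1) 0) ^+ 2
    + cmod (x (inord 2) 0) ^+ 2 + cmod (x (inord 3) 0) ^+ 2 = 1.
    have := congr1 (fun t => t ^+ 2) x1; rewrite expr1n => <-.
    rewrite /vnorm sqr_sqrtr ?sumr_ge0 // => [|i _]; last exact: sqr_ge0.
    have E (i : 'I_4) : cmod (x i 0) ^+ 2 = cmod (x (inord i) 0) ^+ 2.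
      by rewrite inord_val.
    rewrite (eq_bigr _ (fun i _ => E i)).
    by rewrite !big_ord_recl big_ord0 /= /bump /= ?add1n ?addn0 addr0 !addrA.
  have le := @continuant_form_le R (cmod (h 0%N)) (cmod (h 1%N)) (cmod (h 2))
    (Num.sqrt mu) (cmod (x (inord 0) 0)) (cmod (x (inord 1) 0))
    (cmod (x (inord 2) 0)) (cmod (x (inord 3) 0)).
  rewrite n1 mulr1 in le; apply: le; rewrite ?sqrtr_ge0 //.
    by rewrite !h_sqr // s2 s4.
  by rewrite !h_sqr // s2.
have [|w [x x1 e] we] := @re_part_eigen_attained _ _ (z *: A) (Num.sqrt mu).
  by rewrite NR_det_tridiag s2 s4 root.
exists (inner (A *m x) x); first by exists x.
by rewrite zA -e.
Qed.

Lemma largest_root_exists :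
  exists2 mu, mu ^+ 2 - S * mu + entry_sqr (a 0%N) z * entry_sqr (a 2) z = 0 &
    S <= 2 * mu.
Proof.
pose D := S ^+ 2 - 4 * (entry_sqr (a 0%N) z * entry_sqr (a 2) z).
have D0 : 0 <= D.
  have -> : D = (entry_sqr (a 0%N) z - entry_sqr (a 2) z) ^+ 2 +
    entry_sqr (a 1%N) z * (2 * (entry_sqr (a 0%N) z + entry_sqr (a 2) z) + entry_sqr (a 1%N) z).
    by rewrite /D /S; ring.
  have := entry_sqr_ge0 (isT : 0 < 3)%N; have := entry_sqr_ge0 (isT : 1 < 3)%N.
  have := entry_sqr_ge0 (isT : 2 < 3)%N => x2 x1 x0.
  by rewrite addr_ge0 ?sqr_ge0 // mulr_ge0 //; lra.
exists ((S + Num.sqrt D) / 2); last by have := sqrtr_ge0 D; lra.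
have -> : forall q, ((S + Num.sqrt D) / 2) ^+ 2 - S * ((S + Num.sqrt D) / 2) + q =
  (Num.sqrt D ^+ 2 - S ^+ 2 + 4 * q) / 4 by move=> q; field.
by rewrite sqr_sqrtr // /D; field.
Qed.

End Support.
End Reciprocal.

(** * The golden relation *)

Section Golden.
Context {R : realType}.
Local Notation phi := (golden R).

Lemma golden_gt1 : 1 < phi.
Proof.
have : 1 < Num.sqrt (5 : R) by rewrite -{1}sqrtr1 ltr_sqrt; lra.
by rewrite /golden; lra.
Qed.

Lemma golden_sqr : phi ^+ 2 = phi + 1.
Proof.
have s5 : Num.sqrt (5 : R) ^+ 2 = 5 by rewrite sqr_sqrtr //; lra.
rewrite /golden.
have -> : ((Num.sqrt 5 + 1) / 2) ^+ 2 = (Num.sqrt (5 : R) ^+ 2 + 2 * Num.sqrt 5 + 1) / 4.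
  by field.
by rewrite s5; field.
Qed.

Lemma golden_inv : phi^-1 = phi - 1.
Proof.
have p0 : phi != 0 by rewrite gt_eqF //; have := golden_gt1; lra.
apply: (mulfI p0); rewrite mulfV // mulrBr -expr2 golden_sqr; ring.
Qed.

Lemma golden_lt2 : phi < 2.
Proof.
rewrite ltNge; apply/negP => h.
have : 2 * phi <= phi ^+ 2 by rewrite expr2 ler_pM2r //; lra.
rewrite golden_sqr; lra.
Qed.

(** The hypotheses are the coefficients of an identity in tau: x tau + y is a
    root mu of mu^2 - s(tau) mu + (tau + a1) (tau + a3) / 4, where
    s(tau) = (a1 + a2 + a3 + 3 tau) / 2.  Thus mu divides
    (tau + a1) (tau + a3), which gives y = x a1 or y = x a3, and comparing the
    leading coefficients shows that 2 x is phi^2 or phi^-2; these numbers are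
    written [phi + 1] and [2 - phi]. *)
Lemma golden_of_quadratic_factors (a1 a2 a3 x y : R) :
  x ^+ 2 - 3 / 2 * x + 1 / 4 = 0 ->
  2 * x * y - 3 / 2 * y - (a1 + a2 + a3) / 2 * x + (a1 + a3) / 4 = 0 ->
  y ^+ 2 - (a1 + a2 + a3) / 2 * y + a1 * a3 / 4 = 0 ->
  (y = x * a1 \/ y = x * a3) /\
  (a2 = phi * a1 - phi^-1 * a3 \/ a2 = phi * a3 - phi^-1 * a1).
Proof.
move=> e1 e2 e3.
have hx : 2 * x = phi + 1 \/ 2 * x = 2 - phi.
  have /eqP : (2 * x - (phi + 1)) * (2 * x - (2 - phi)) = 0.
    have -> : (2 * x - (phi + 1)) * (2 * x - (2 - phi)) =
      4 * (x ^+ 2 - 3 / 2 * x + 1 / 4) + (phi + 1 - phi ^+ 2) by field.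
    by rewrite e1 golden_sqr; ring.
  by rewrite mulf_eq0 !subr_eq0 => /orP[] /eqP; auto.
(* Evaluation of the identity at tau = - y / x, with denominators cleared. *)
have hy : y = x * a1 \/ y = x * a3.
  have /eqP : (y - x * a1) * (y - x * a3) = 0.
    have -> : (y - x * a1) * (y - x * a3) = 4 * (y ^+ 2 * (x ^+ 2 - 3 / 2 * x + 1 / 4)
       - y * x * (2 * x * y - 3 / 2 * y - (a1 + a2 + a3) / 2 * x + (a1 + a3) / 4)
       + x ^+ 2 * (y ^+ 2 - (a1 + a2 + a3) / 2 * y + a1 * a3 / 4)) by field.
    by rewrite e1 e2 e3; ring.
  by rewrite mulf_eq0 !subr_eq0 => /orP[] /eqP; auto.
split=> //.
have [g1 g2] := (golden_gt1, golden_lt2).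
have psq := golden_sqr.
rewrite !golden_inv.
have x0 : 0 < x by case: hx; lra.
have step (p q : R) : y = x * p ->
   2 * x * y - 3 / 2 * y - (p + a2 + q) / 2 * x + (p + q) / 4 = 0 ->
   a2 * (2 * x) = (2 * p - q) * (2 * x) - (p - q).
  move=> yE h; have : (2 * p * (x ^+ 2 - 3 / 2 * x + 1 / 4)) = 0 by rewrite e1 mulr0.
  by rewrite yE in h; lra.
have fin1 (p q : R) : 2 * x = phi + 1 ->
   a2 * (2 * x) = (2 * p - q) * (2 * x) - (p - q) -> a2 = phi * p - (phi - 1) * q.
  move=> h; have x20 : 2 * x != 0 by lra.
  move=> s; apply: (mulIf x20); rewrite s h.
  have -> : (phi * p - (phi - 1) * q) * (phi + 1) = phi ^+ 2 * (p - q) + phi * p + q by ring.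
  by rewrite psq; ring.
have fin2 (p q : R) : 2 * x = 2 - phi ->
   a2 * (2 * x) = (2 * p - q) * (2 * x) - (p - q) -> a2 = phi * q - (phi - 1) * p.
  move=> h; have x20 : 2 * x != 0 by lra.
  move=> s; apply: (mulIf x20); rewrite s h.
  have -> : (phi * q - (phi - 1) * p) * (2 - phi) =
     2 * phi * (q - p) - phi ^+ 2 * (q - p) + p * (2 - phi) by ring.
  by rewrite psq; ring.
have e2' : 2 * x * y - 3 / 2 * y - (a3 + a2 + a1) / 2 * x + (a3 + a1) / 4 = 0.
  by rewrite -e2; ring.
case: hy => hy; case: hx => hx.
- by left; apply: fin1 => //; exact: step.
- by right; apply: fin2 => //; exact: step.
- by right; apply: fin1 => //; exact: step.
- by left; apply: fin2 => //; exact: step.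
Qed.

End Golden.

Section Elliptic.
Context {R : realType}.
Implicit Types (z w : R[i]).
Local Notation phi := (golden R).

Lemma entry_sqrN (a : R) z : entry_sqr a (- z) = entry_sqr a z.
Proof. by rewrite /entry_sqr cReN cImN !sqrrN. Qed.

Section Necessity.
Variables (b c : nat -> R[i]) (a : nat -> R).
Hypothesis bc1 : forall j, (j < 3)%N -> b j * c j = 1.
Hypothesis aE : forall j, (j < 3)%N -> a j = (cmod (b j) ^+ 2 + cmod (c j) ^+ 2) / 2.
Let A := tridiag b c.

(** The center of the ellipse drops out: the support values of the numerical
    range in the directions [z] and [- z] agree, while those of the ellipse
    differ by twice the contribution of the center. *)
Lemma width2_of_elliptical (E : ellipse R) z mu :
  ellipse_nondegenerate E -> numerical_range A = ellipse_disk E -> z != 0 ->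
  mu ^+ 2 - (entry_sqr (a 0%N) z + entry_sqr (a 1%N) z + entry_sqr (a 2) z) * mu
     + entry_sqr (a 0%N) z * entry_sqr (a 2) z = 0 ->
  entry_sqr (a 0%N) z + entry_sqr (a 1%N) z + entry_sqr (a 2) z <= 2 * mu ->
  width2 (major E / 2) (half_focal E) z = mu.
Proof.
move=> nd WE z0 root big.
set wd := width2 _ _ _.
have w0 : 0 < wd by apply: width2_gt0 => //; exact: half_focal_lt.
have s1 := tridiag_support bc1 aE root big.
have s2 : support_value (numerical_range A) (- z) (Num.sqrt mu).
  by apply: (tridiag_support bc1 aE); rewrite !entry_sqrN.
have zN0 : - z != 0 by rewrite oppr_eq0.
have t1 := ellipse_support nd z0; have t2 := ellipse_support nd zN0.
rewrite -WE in t1 t2; rewrite mulNr cReN in t2.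
have wN : width2 (major E / 2) (half_focal E) (- z) = wd.
  by rewrite /wd /width2 mulNr !cImN cReN !sqrrN.
rewrite wN -/wd in t1 t2.
have h1 := support_value_uniq s1 t1; have h2 := support_value_uniq s2 t2.
have e : Num.sqrt mu = Num.sqrt wd by lra.
have mu0 : 0 < mu by rewrite -sqrtr_gt0 e sqrtr_gt0.
by rewrite -(sqr_sqrtr (ltW mu0)) e sqr_sqrtr // ltW.
Qed.

(** The squared width of the ellipse in every direction is a root of the
    characteristic polynomial.  A quadratic polynomial in tau = cos (2 theta)
    vanishes identically as soon as it vanishes for tau = 1, -1, 0, which are
    the directions 1, i and 1 + i.  If all three means were 1, the width in the
    direction i would vanish, which a non-degenerate ellipse excludes. *)
Lemma golden_of_elliptical : elliptical (numerical_range A) ->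
  (a 1%N = phi * a 0%N - phi^-1 * a 2 \/ a 1%N = phi * a 2 - phi^-1 * a 0%N) /\
  (1 < a 0%N \/ 1 < a 1%N \/ 1 < a 2).
Proof.
move=> [E nd WE].
pose f := half_focal E; pose m := major E / 2.
have wpos z : z != 0 -> 0 < width2 m f z.
  by move=> z0; apply: width2_gt0 => //; exact: half_focal_lt.
have nz1 : (1 : R[i]) != 0 by rewrite oner_eq0.
have nzi : (0 +i* 1 : R[i]) != 0 by rewrite eq_complex /= oner_eq0 andbF.
have nzp : (1 +i* 1 : R[i]) != 0 by rewrite eq_complex /= oner_eq0.
have nzm : (1 +i* (-1) : R[i]) != 0 by rewrite eq_complex /= oner_eq0.
have root z : z != 0 -> width2 m f z ^+ 2
   - (entry_sqr (a 0%N) z + entry_sqr (a 1%N) z + entry_sqr (a 2) z) * width2 m f z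
     + entry_sqr (a 0%N) z * entry_sqr (a 2) z = 0.
  move=> z0; have [mu r big] := largest_root_exists bc1 aE z.
  by rewrite (width2_of_elliptical nd WE z0 r big).
(* The directions 1 + i and 1 - i have the same characteristic polynomial:
   the focal axis is horizontal or vertical. *)
have fc : Re f * Im f = 0.
  have [mu r big] := largest_root_exists bc1 aE (1 +i* 1).
  have e1 := width2_of_elliptical nd WE nzp r big.
  have entry_sqr_conj t : entry_sqr t (1 +i* (-1) : R[i]) = entry_sqr t (1 +i* 1).
    by rewrite /entry_sqr /= sqrrN.
  have e2 : width2 m f (1 +i* (-1)) = mu.
    by apply: width2_of_elliptical => //; rewrite !entry_sqr_conj.
  move: e2; rewrite -e1 /width2 -/f -/m !cImM /=; lra.
pose P := m ^+ 2.
pose w1 := P - Im f ^+ 2; pose w2 := P - Re f ^+ 2.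
have W1 : width2 m f 1 = w1 by rewrite /width2 mul1r /= /w1 /P; ring.
have W2 : width2 m f (0 +i* 1) = w2 by rewrite /width2 cImM /= /w2 /P; ring.
have W3 : width2 m f (1 +i* 1) = w1 + w2.
  have -> : w1 + w2 = w1 + w2 - 2 * (Re f * Im f) by rewrite fc mulr0 subr0.
  by rewrite /width2 cImM /= /w1 /w2 /P; ring.
have := root _ nz1; have := root _ nzi; have := root _ nzp.
rewrite W1 W2 W3 /entry_sqr /= => r3 r2 r1.
pose x := (w1 - w2) / 2; pose y := (w1 + w2) / 2.
have w1E : w1 = y + x by rewrite /x /y; field.
have w2E : w2 = y - x by rewrite /x /y; field.
have w2p : 0 < w2 by rewrite -W2 wpos.
rewrite {}w1E {}w2E in r1 r2 r3 w2p.
have [hy hg] := @golden_of_quadratic_factors R (a 0%N) (a 1%N) (a 2) x y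
  ltac:(lra) ltac:(lra) ltac:(lra).
split=> //.
have g0 := recip_mean_ge1 bc1 aE (isT : 0 < 3)%N.
have g1 := recip_mean_ge1 bc1 aE (isT : 1 < 3)%N.
have g2 := recip_mean_ge1 bc1 aE (isT : 2 < 3)%N.
have [|h0] := ltP 1 (a 0%N); first by left.
have [|h1] := ltP 1 (a 1%N); first by right; left.
have [|h2] := ltP 1 (a 2); first by right; right.
have [E0 E2] : a 0%N = 1 /\ a 2 = 1 by split; lra.
by exfalso; move: hy; rewrite E0 E2; lra.
Qed.

End Necessity.

(** A numerical range with the support values of an ellipse is that ellipse.
    The normal [nu w] turns the inequality between support values into the
    equation of the ellipse.  A support line meets the ellipse at one point
    only, so that the boundary is attained; horizontal chords and convexity
    then fill the inside. *)
Lemma numerical_range_axial n (A : 'M[R[i]]_n) (a f : R) (a0 : 0 < a) (fa : 0 <= f <= a) :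
  f < a ->
  (forall z, z != 0 ->
    support_value (numerical_range A) z (Num.sqrt (width2 a f%:C z))) ->
  numerical_range A = ellipse_disk (axial_ellipse a0 fa).
Proof.
move=> lt supp.
pose b2 := a ^+ 2 - f ^+ 2.
have b20 : 0 < b2 by case/andP: (fa) => f0 _; rewrite subr_gt0 -ltr_sqr_nneg // ltW.
have a20 : 0 < a ^+ 2 by rewrite exprn_gt0.
have K0 : 0 < a ^+ 2 * b2 by rewrite mulr_gt0.
pose q w := b2 * Re w ^+ 2 + a ^+ 2 * Im w ^+ 2.
have q0 w : q w <= 0 -> w = 0.
  move=> h; have i1 : 0 <= b2 * Re w ^+ 2 by rewrite mulr_ge0 ?sqr_ge0 // ltW.
  have i2 : 0 <= a ^+ 2 * Im w ^+ 2 by rewrite mulr_ge0 ?sqr_ge0 // ltW.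
  have /eqP : b2 * Re w ^+ 2 = 0 by rewrite /q in h; lra.
  have /eqP : a ^+ 2 * Im w ^+ 2 = 0 by rewrite /q in h; lra.
  rewrite mulf_eq0 (gt_eqF a20) sqrf_eq0 => /eqP hi.
  rewrite mulf_eq0 (gt_eqF b20) sqrf_eq0 => /eqP hr.
  exact: complex_ext.
pose nu w : R[i] := (b2 * Re w) +i* (- (a ^+ 2 * Im w)).
have nuE w w' : Re (nu w * w') = b2 * Re w * Re w' + a ^+ 2 * Im w * Im w'.
  by rewrite cReM /=; ring.
have nuq w : Re (nu w * w) = q w by rewrite nuE /q; ring.
have nuW w : width2 a f%:C (nu w) = a ^+ 2 * b2 * q w.
  by rewrite /width2 cImM /= /q /b2; ring.
have nu0 w : w != 0 -> nu w != 0.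
  apply: contra_neq => e; apply: q0.
  by rewrite -nuq e mul0r.
have sub w : numerical_range A w -> q w <= a ^+ 2 * b2.
  move=> Ww; have [->|w0] := eqVneq w 0.
    by rewrite /q /= expr0n /= !mulr0 addr0 ltW.
  have qp : 0 < q w by rewrite ltNge; apply: contra w0 => /q0 ->.
  have [h _] := supp _ (nu0 _ w0); have := h _ Ww; rewrite nuq nuW.
  rewrite ler_sqr_nneg ?sqrtr_ge0 // ?(ltW qp) // sqr_sqrtr;
    last by rewrite mulr_ge0 // ltW.
  by rewrite expr2 ler_pM2r.
have bd w : q w = a ^+ 2 * b2 -> numerical_range A w.
  move=> qw.
  have w0 : w != 0.
    by apply: contraTneq K0 => w0; rewrite -qw w0 /q /= expr0n /= !mulr0 addr0 ltxx.
  have [_ [w' Ww' e]] := supp _ (nu0 _ w0).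
  suff -> : w = w' by [].
  rewrite nuW qw -expr2 sqrtr_sqr gtr0_norm // in e.
  have := sub _ Ww' => qw'.
  apply/eqP; rewrite -subr_eq0; apply/eqP/q0.
  have -> : q (w - w') = q w + q w' - 2 * Re (nu w * w').
    by rewrite nuE /q !complex_partsE; ring.
  by rewrite e qw; lra.
apply/seteqP; split=> w; rewrite axial_diskE //; first exact: sub.
rewrite -/b2 -/(q w) => qw.
pose u := Num.sqrt ((a ^+ 2 * b2 - a ^+ 2 * Im w ^+ 2) / b2).
have rw : Re w ^+ 2 <= (a ^+ 2 * b2 - a ^+ 2 * Im w ^+ 2) / b2.
  by rewrite ler_pdivlMr //; rewrite /q in qw; lra.
have u2 : u ^+ 2 = (a ^+ 2 * b2 - a ^+ 2 * Im w ^+ 2) / b2.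
  by rewrite sqr_sqrtr // (le_trans _ rw) ?sqr_ge0.
have u0 : 0 <= u by rewrite sqrtr_ge0.
have wu : `|Re w| <= u by rewrite -sqrtr_sqr ler_wsqrtr.
have ends (s : R) : s ^+ 2 = u ^+ 2 -> numerical_range A (s +i* Im w).
  move=> su; apply: bd; rewrite /q /= su u2; field; exact: lt0r_neq0.
have [u00|un0] := eqVneq u 0.
  suff -> : w = 0 +i* Im w by apply: ends; rewrite u00.
  apply: complex_ext => //=; apply/eqP; rewrite -normr_eq0 eq_le normr_ge0 andbT.
  by rewrite -u00.
have up : 0 < u by rewrite lt_def un0.
move: wu; rewrite ler_norml => /andP[wl wr].
pose t := (Re w + u) / (2 * u).
have -> : w = (1 - t)%:C * ((- u) +i* Im w) + t%:C * (u +i* Im w).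
  apply: complex_ext; rewrite !complex_partsE /= /t; field; exact: lt0r_neq0.
apply: numerical_range_convex; [by apply: ends; rewrite sqrrN|exact: ends|].
rewrite /t divr_ge0 ?ler_pdivrMr; lra.
Qed.

End Elliptic.

Local Open Scope classical_set_scope.

(** * The Kippenhahn curve *)

Section Curve.
Context {R : realType}.
Implicit Types (a f t theta : R) (l : R -> R).

Lemma exists_angle (x y : R) : x ^+ 2 + y ^+ 2 = 1 ->
  exists theta, cos theta = x /\ sin theta = y.
Proof.
move=> xy; have x1 : -1 <= x <= 1.
  by rewrite -ler_norml -sqrtr_sqr -[X in _ <= X]sqrtr1 ler_wsqrtr //;
     have := sqr_ge0 y; lra.
have s : sin (acos x) = `|y|.
  by rewrite sin_acos // -sqrtr_sqr; congr Num.sqrt; lra.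
have c : cos (acos x) = x by rewrite acosK // in_itv.
have [y0|y0] := leP 0 y.
  by exists (acos x); rewrite c s ger0_norm.
by exists (- acos x); rewrite cosN sinN c s ltr0_norm // opprK.
Qed.

Lemma derivable_continuous l theta : derivable l theta 1 -> l @ theta --> l theta.
Proof. by move=> /derivable1_diffP/differentiable_continuous. Qed.

(** Where p and q differ, a continuous function whose square is p or q at each
    point cannot jump from one to the other. *)
Lemma sqr_near_branch l (p q : R -> R) theta :
  {for theta, continuous l} -> {for theta, continuous q} ->
  (forall t, l t ^+ 2 = p t \/ l t ^+ 2 = q t) ->
  l theta ^+ 2 != q theta -> \forall t \near theta, l t ^+ 2 = p t.
Proof.
move=> lc qc pq n0.
have gc : (fun t => l t ^+ 2 - q t) @ theta --> l theta ^+ 2 - q theta.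
  apply: cvgB => //; rewrite expr2; under eq_fun do rewrite expr2.
  exact: cvgM.
have : \forall t \near theta, l t ^+ 2 - q t != 0.
  by apply: (cvgr_neq0 _ gc); rewrite subr_eq0.
apply: filterS => t; rewrite subr_eq0 => ne.
by case: (pq t) => // e; rewrite e eqxx in ne.
Qed.

(** Near [theta], [l] is a differentiable square root of the squared width of
    the axial ellipse with parameters [a] and [f]. *)
Definition width_branch a f l theta : Prop :=
  derivable l theta 1 /\
  \forall t \near theta, l t ^+ 2 = a ^+ 2 - f ^+ 2 * sin t ^+ 2.

Lemma width_branch_mul_derive a f l theta : width_branch a f l theta ->
  l theta * derive1 l theta = - f ^+ 2 * sin theta * cos theta.
Proof.
move=> [dl near_l]; rewrite derive1E.
have d1 : is_derive theta 1 (fun t => l t ^+ 2) (2 * l theta * 'D_1 l theta).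
  have /derivableP dl' := dl.
  by apply: is_derive_eq; rewrite /= /GRing.scale /=; ring.
have d2 : is_derive theta 1 (fun t => a ^+ 2 - f ^+ 2 * sin t ^+ 2)
   (- f ^+ 2 * (2 * sin theta * cos theta)).
  apply: is_derive_eq; rewrite /= /GRing.scale /=; ring.
have d3 := near_eq_is_derive near_l d1.
have : 2 * l theta * 'D_1 l theta = - f ^+ 2 * (2 * sin theta * cos theta).
  by rewrite -(@derive_val _ _ _ _ _ _ _ d3) (@derive_val _ _ _ _ _ _ _ d2).
lra.
Qed.

(** At a zero of [l], which only occurs for a doubleton of foci, differentiating
    [l ^+ 2] does not determine the derivative of [l]; its square is obtained
    by comparing the difference quotients of [l] and of [a * cos]. *)
Lemma width_branch_sqr_derive a l theta : width_branch a a l theta ->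
  cos theta = 0 -> derive1 l theta ^+ 2 = a ^+ 2.
Proof.
move=> [dl near_l] c0; rewrite derive1E.
have near_c : \forall t \near theta, l t ^+ 2 = (a * cos t) ^+ 2.
  by apply: filterS near_l => t ->; rewrite exprMn cos2sin2; ring.
have l0 : l theta = 0.
  apply/eqP; rewrite -sqrf_eq0; have := nbhs_singleton near_c; rewrite c0 => ->.
  by rewrite mulr0 expr0n.
pose quot (g : R -> R) (h : R) := h^-1 *: ((g \o shift theta) (h *: 1) - g theta).
have cl : quot l @ 0^' --> 'D_1 l theta by exact: dl.
have cc : quot cos @ 0^' --> 'D_1 (cos : R -> R) theta by exact: derivable_cos.
have clsq : (fun h => quot l h * quot l h) @ 0^' --> 'D_1 l theta * 'D_1 l theta.
  exact: cvgM.
have ccsq : (fun h => a ^+ 2 * (quot cos h * quot cos h)) @ 0^' -->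
    a ^+ 2 * ('D_1 (cos : R -> R) theta * 'D_1 (cos : R -> R) theta).
  by apply: cvgM; [exact: cvg_cst|exact: cvgM].
have sh : (fun h : R => h *: 1 + theta) @ 0^' --> theta.
  apply: cvg_within_filter.
  have : (fun h : R => h *: (1 : R) + theta) @ (0 : R) --> (0 : R) *: (1 : R) + theta.
    by apply: cvgD; [apply: cvgZl; exact: cvg_id|exact: cvg_cst].
  by rewrite scale0r add0r.
have eq_near : \forall h \near (0 : R)^',
  l (h *: 1 + theta) ^+ 2 = (a * cos (h *: 1 + theta)) ^+ 2 := sh _ near_c.
have eqF : {near 0^', (fun h => a ^+ 2 * (quot cos h * quot cos h)) =1
                     (fun h => quot l h * quot l h)}.
  apply: filterS eq_near => h /= e; rewrite /quot /= l0 c0 !subr0.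
  rewrite /GRing.scale /= in e *.
  have -> : h^-1 * l (h * 1 + theta) * (h^-1 * l (h * 1 + theta)) =
     h^-1 ^+ 2 * l (h * 1 + theta) ^+ 2 by ring.
  by rewrite e; ring.
rewrite expr2 (cvg_unique (@norm_hausdorff _ _) clsq (cvg_trans (near_eq_cvg eqF) ccsq)).
have -> : 'D_1 (cos : R -> R) theta = - sin theta by exact: derive_val.
by rewrite mulrNN -[sin _ * sin _]expr2 sin2cos2 c0 expr0n subr0 mulr1.
Qed.

(** The point where the line with normal angle [theta] touches the envelope. *)
Definition contact l theta : R[i] := expi (- theta) * (l theta -i* derive1 l theta).

Lemma Re_contact l theta :
  Re (contact l theta) = cos theta * l theta - sin theta * derive1 l theta.
Proof. by rewrite /contact /expi cosN sinN cReM /=; ring. Qed.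

Lemma Im_contact l theta :
  Im (contact l theta) = - (sin theta * l theta + cos theta * derive1 l theta).
Proof. by rewrite /contact /expi cosN sinN cImM /=; ring. Qed.

Section AxialContact.
Variables (a f : R) (a0 : 0 < a) (fa : 0 <= f <= a).
Let E := axial_ellipse a0 fa.

(** The derivative of [l ^+ 2] expresses the coordinates of the contact point,
    multiplied by [l theta], in terms of the sine and cosine only; eliminating
    these gives the equation of the ellipse.  In the degenerate case the same
    computation gives one of the foci. *)
Lemma contact_on_ellipse l theta :
  width_branch a f l theta -> ellipse_curve E (contact l theta).
Proof.
move=> wb.
have ld := width_branch_mul_derive wb.
have l2 : l theta ^+ 2 = a ^+ 2 - f ^+ 2 * sin theta ^+ 2.
  by case: wb => _ /nbhs_singleton.
have cs := cos2Dsin2 theta.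
have fa2 : f ^+ 2 <= a ^+ 2 by case/andP: (fa) => f0 le; rewrite -ler_sqr_nneg // ltW.
have sc : sin theta ^+ 2 = 1 - cos theta ^+ 2 by lra.
have lre : l theta * Re (contact l theta) = a ^+ 2 * cos theta.
  transitivity (cos theta * l theta ^+ 2 - sin theta * (l theta * derive1 l theta)).
    by rewrite Re_contact; ring.
  by rewrite l2 ld; ring.
have lim : l theta * Im (contact l theta) = - (a ^+ 2 - f ^+ 2) * sin theta.
  transitivity (- (sin theta * l theta ^+ 2 + cos theta * (l theta * derive1 l theta))).
    by rewrite Im_contact; ring.
  rewrite l2 ld.
  have -> : cos theta * (- f ^+ 2 * sin theta * cos theta)
    = - f ^+ 2 * sin theta * cos theta ^+ 2 by ring.
  by rewrite [cos theta ^+ 2]cos2sin2; ring.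
move: (contact l theta) (Re_contact l theta) (Im_contact l theta) lre lim.
move=> w reE imE lre lim.
case/andP: (fa) => f0; rewrite le_eqVlt => /orP[/eqP fE|lt].
  right; split; first by rewrite axial_nondegenerate fE ltxx.
  have [re2 im0] : Re w ^+ 2 = a ^+ 2 /\ Im w = 0.
    have [l0|ln0] := eqVneq (l theta) 0.
      have c0 : cos theta = 0.
        have /eqP : a ^+ 2 * cos theta ^+ 2 = 0.
          by rewrite cos2sin2 mulrBr mulr1 -{2}fE -l2 l0 expr0n.
        by rewrite mulf_eq0 !sqrf_eq0 gt_eqF //= => /eqP.
      have d2 : derive1 l theta ^+ 2 = a ^+ 2.
        by apply: width_branch_sqr_derive c0; rewrite -{2}fE.
      rewrite reE imE l0 c0 !mulr0 mul0r addr0 sub0r oppr0; split=> //.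
      by rewrite sqrrN exprMn d2 sin2cos2 c0 expr0n subr0 mul1r.
    split; last by apply: (mulfI ln0); rewrite lim mulr0 fE subrr oppr0 mul0r.
    have l2n0 : l theta ^+ 2 != 0 by rewrite sqrf_eq0.
    apply: (mulfI l2n0); rewrite -exprMn lre l2 fE.
    have -> : (a ^+ 2 * cos theta) ^+ 2 = a ^+ 2 ^+ 2 * (1 - sin theta ^+ 2).
      by rewrite exprMn cos2sin2.
    ring.
  have /eqP : (Re w - a) * (Re w + a) = 0 by rewrite -subr_sqr re2 subrr.
  rewrite mulf_eq0 subr_eq0 addr_eq0 => /orP[] /eqP re.
    by left; apply: complex_ext => /=; rewrite ?re ?fE.
  by right; apply: complex_ext => /=; rewrite ?re ?fE ?oppr0.
apply/axial_curveE => //.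
have b0 : 0 < a ^+ 2 - f ^+ 2 by rewrite subr_gt0 -ltr_sqr_nneg // ltW.
have l20 : l theta ^+ 2 != 0.
  rewrite l2 gt_eqF // (lt_le_trans b0) // lerD2l lerN2 ler_piMr ?sqr_ge0 //.
  by rewrite sc gerBl sqr_ge0.
apply: (mulfI l20).
have -> : l theta ^+ 2 * ((a ^+ 2 - f ^+ 2) * Re w ^+ 2 + a ^+ 2 * Im w ^+ 2) =
  (a ^+ 2 - f ^+ 2) * (l theta * Re w) ^+ 2 + a ^+ 2 * (l theta * Im w) ^+ 2 by ring.
rewrite lre lim l2.
have -> : (a ^+ 2 * cos theta) ^+ 2 = a ^+ 2 ^+ 2 * (1 - sin theta ^+ 2).
  by rewrite exprMn cos2sin2.
ring.
Qed.

(** A point of a proper ellipse is the contact point for the angle of its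
    normal, on the branch given by the positive square root.  For a doubleton
    the lines of the smooth branches [a * cos] and [- a * cos] all pass through
    one focus. *)
Lemma ellipse_point_contact w : ellipse_curve E w ->
  exists l theta, (forall t, derivable l t 1 /\
     l t ^+ 2 = a ^+ 2 - f ^+ 2 * sin t ^+ 2) /\ w = contact l theta.
Proof.
case/andP: (fa) => f0; rewrite le_eqVlt => /orP[/eqP fE|lt].
  have ok (e : R) : e ^+ 2 = 1 -> w = (e * a)%:C -> 
     exists l theta, (forall t, derivable l t 1 /\
     l t ^+ 2 = a ^+ 2 - f ^+ 2 * sin t ^+ 2) /\ w = contact l theta.
    move=> e1 we; exists (fun t => e * a * cos t), 0; split=> [t|].
      split; last by rewrite !exprMn e1 cos2sin2 fE; ring.
      exact: ex_derive.
    rewrite we; apply: complex_ext; first by rewrite Re_contact cos0 sin0 /=; ring.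
    rewrite Im_contact sin0 cos0 derive1E.
    have -> : 'D_1 (fun t : R => e * a * cos t) 0 = 0.
      have h : is_derive (0 : R) (1 : R) (fun t : R => e * a * cos t) 0.
        by apply: is_derive_eq; rewrite /GRing.scale /= sin0; ring.
      exact: derive_val.
    by rewrite /=; ring.
  case=> [[/(axial_nondegenerate a0 fa)]|[_ [] wE]].
  - by rewrite fE ltxx.
  - by apply: (ok 1); rewrite ?expr1n // mul1r -fE.
  - by apply: (ok (-1)); rewrite ?sqrrN ?expr1n // mulN1r -fE.
move=> /(axial_curveE a0 fa _ lt) hw.
have b0 : 0 < a ^+ 2 - f ^+ 2 by rewrite subr_gt0 -ltr_sqr_nneg // ltW.
have a20 : 0 < a ^+ 2 by rewrite exprn_gt0.
have pos t : 0 < a ^+ 2 - f ^+ 2 * sin t ^+ 2.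
  rewrite (lt_le_trans b0) // lerD2l lerN2 ler_piMr ?sqr_ge0 //.
  by rewrite sin2cos2 gerBl sqr_ge0.
pose l t := Num.sqrt (a ^+ 2 - f ^+ 2 * sin t ^+ 2).
have lb t : derivable l t 1 /\ l t ^+ 2 = a ^+ 2 - f ^+ 2 * sin t ^+ 2.
  split; last by rewrite sqr_sqrtr // ltW.
  have d1 := is_derive1_sqrt (pos t).
  by apply: ex_derive.
pose b2 := a ^+ 2 - f ^+ 2.
have K0 : 0 < a ^+ 2 * b2 by rewrite mulr_gt0.
pose r2 := (b2 * Re w) ^+ 2 + (a ^+ 2 * Im w) ^+ 2.
have r2p : 0 < r2.
  have [e|re] := eqVneq (Re w) 0; last first.
    by rewrite ltr_pwDl ?sqr_ge0 // exprn_even_gt0 //= mulf_neq0 // gt_eqF.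
  have [e'|ie] := eqVneq (Im w) 0; last first.
    by rewrite ltr_wpDl ?sqr_ge0 // exprn_even_gt0 //= mulf_neq0 // gt_eqF.
  by move: K0; rewrite -hw e e' expr0n /= !mulr0 addr0 ltxx.
pose r := Num.sqrt r2.
have rp : 0 < r by rewrite sqrtr_gt0.
have rr : r ^+ 2 = r2 by rewrite sqr_sqrtr // ltW.
have rn : r != 0 by rewrite gt_eqF.
have [|theta [ct st]] := @exists_angle (b2 * Re w / r) (- (a ^+ 2 * Im w) / r).
  transitivity (r2 / r ^+ 2); first by rewrite /r2; field.
  by rewrite rr mulfV // gt_eqF.
exists l, theta; split=> //.
have [dl l2] := lb theta.
have wb : width_branch a f l theta by split=> //; near=> t; exact: (lb t).2.
have ld := width_branch_mul_derive wb.
have lE : l theta = a ^+ 2 * b2 / r.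
  apply/eqP; rewrite -(@eqrXn2 _ 2) // ?sqrtr_ge0 //; last first.
    by rewrite divr_ge0 // ltW.
  rewrite l2 st; apply/eqP; apply: (mulIf (expf_neq0 2 rn)).
  have -> : (a ^+ 2 - f ^+ 2 * (- (a ^+ 2 * Im w) / r) ^+ 2) * r ^+ 2 =
     a ^+ 2 * r ^+ 2 - f ^+ 2 * (a ^+ 2 * Im w) ^+ 2 by field.
  have -> : (a ^+ 2 * b2 / r) ^+ 2 * r ^+ 2 = (a ^+ 2 * b2) * (a ^+ 2 * b2) by field.
  by rewrite rr /r2 -{2}hw /b2; ring.
have ln : l theta != 0 by rewrite gt_eqF // sqrtr_gt0.
apply: complex_ext; apply: (mulfI ln).
  transitivity (cos theta * l theta ^+ 2 - sin theta * (l theta * derive1 l theta)).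
    rewrite l2 ld.
    transitivity (cos theta * a ^+ 2).
      by rewrite lE ct; field.
    by ring.
  by rewrite Re_contact; ring.
transitivity (- (sin theta * l theta ^+ 2 + cos theta * (l theta * derive1 l theta))).
  rewrite l2 ld.
  have -> : cos theta * (- f ^+ 2 * sin theta * cos theta)
    = - f ^+ 2 * sin theta * cos theta ^+ 2 by ring.
  rewrite [cos theta ^+ 2]cos2sin2.
  transitivity (- (b2 * sin theta)); last by rewrite /b2; ring.
  by rewrite lE st; field.
by rewrite Im_contact; ring.
Unshelve. all: by end_near. Qed.

End AxialContact.

(** As the two factors never have a common root in [lam ^+ 2], every smooth
    eigenvalue branch belongs to one of the two ellipses near each angle. *)
Lemma kippenhahn_two_axial n (A : 'M[R[i]]_n) a1 f1 a2 f2
    (a10 : 0 < a1) (fa1 : 0 <= f1 <= a1) (a20 : 0 < a2) (fa2 : 0 <= f2 <= a2) :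
  let E1 := axial_ellipse a10 fa1 in let E2 := axial_ellipse a20 fa2 in
  (forall lam t, NR_poly A lam t =
    (ellipse_factor E1 lam t * ellipse_factor E2 lam t)%:C) ->
  (forall t, a2 ^+ 2 - f2 ^+ 2 * sin t ^+ 2 < a1 ^+ 2 - f1 ^+ 2 * sin t ^+ 2) ->
  kippenhahn_union A E1 E2.
Proof.
move=> E1 E2 fac sep; split=> //.
have branchE lam t : NR_poly A lam t = 0 <->
    lam ^+ 2 = a1 ^+ 2 - f1 ^+ 2 * sin t ^+ 2 \/
    lam ^+ 2 = a2 ^+ 2 - f2 ^+ 2 * sin t ^+ 2.
  rewrite fac !axial_factor; split.
    move=> /(@complexI R) /eqP; rewrite mulf_eq0 !subr_eq0.
    by case/orP => /eqP; auto.
  by case=> ->; rewrite subrr ?mul0r ?mulr0.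
have wcont a f : continuous (fun t : R => a ^+ 2 - f ^+ 2 * sin t ^+ 2).
  move=> t; apply: derivable_continuous; exact: ex_derive.
apply/seteqP; split=> w.
  move=> [l lb [theta ->]]; rewrite -/(contact l theta).
  have dl : derivable l theta 1 by case: (lb theta).
  have lc := derivable_continuous dl.
  have bt t := (branchE (l t) t).1 (lb t).2.
  case: (bt theta) => e.
    left; apply: contact_on_ellipse; split=> //.
    apply: (sqr_near_branch lc (wcont a2 f2 theta)) => //.
    by rewrite e gt_eqF.
  right; apply: contact_on_ellipse; split=> //.
  apply: (sqr_near_branch lc (wcont a1 f1 theta)) => [t|].
    by case: (bt t); auto.
  by rewrite e lt_eqF.
case=> /ellipse_point_contact [l [theta [lb ->]]]; exists l; try by exists theta.
  by move=> t; case: (lb t) => dl l2; split=> //; apply/branchE; left.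
by move=> t; case: (lb t) => dl l2; split=> //; apply/branchE; right.
Qed.

End Curve.

(** * Sufficiency of the golden relation *)

Section Sufficiency.
Context {R : realType}.
Local Notation phi := (golden R).

(** [k ^+ 2 * entry_sqr al] is the squared width of the axial ellipse with foci
    [k] and [- k] and this semi-major axis. *)
Definition scaled_major (k al : R) : R := k * Num.sqrt ((al + 1) / 2).

Lemma sqr_scaled_major k al : 1 <= al ->
  scaled_major k al ^+ 2 = k ^+ 2 * ((al + 1) / 2).
Proof. by move=> h; rewrite exprMn sqr_sqrtr //; lra. Qed.

Lemma scaled_major_gt0 k al : 0 < k -> 1 <= al -> 0 < scaled_major k al.
Proof. by move=> k0 h; rewrite mulr_gt0 // sqrtr_gt0; lra. Qed.

Lemma scaled_major_ge k al : 0 < k -> 1 <= al -> 0 <= k <= scaled_major k al.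
Proof.
move=> k0 h; rewrite (ltW k0) /=.
rewrite ler_sqr_nneg ?(ltW k0) ?(ltW (scaled_major_gt0 k0 h)) // sqr_scaled_major //.
by rewrite ler_peMr ?sqr_ge0 //; lra.
Qed.

Lemma width2_scaled_major k al (z : R[i]) : 1 <= al ->
  width2 (scaled_major k al) k%:C z = k ^+ 2 * entry_sqr al z.
Proof.
by move=> h; rewrite /width2 sqr_scaled_major // cImM /= /entry_sqr; field.
Qed.

(** The gap is phi (m - 1) + phi^-1 (be - 1) + sqrt 5 (t + 1), where [m] is the
    middle mean: a sum of nonnegative terms that vanish together only if all
    three means are 1. *)
Lemma golden_factors_gap (al be t : R) :
  1 <= be -> 1 <= phi * al - phi^-1 * be ->
  1 < al \/ 1 < phi * al - phi^-1 * be \/ 1 < be -> -1 <= t <= 1 ->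
  phi^-1 ^+ 2 * (be + t) < phi ^+ 2 * (al + t).
Proof.
have g1 := @golden_gt1 R; have g2 := @golden_lt2 R; have psq := @golden_sqr R.
have -> : phi^-1 ^+ 2 = 2 - phi.
  rewrite golden_inv; have -> : (phi - 1) ^+ 2 = phi ^+ 2 - 2 * phi + 1 by ring.
  by rewrite psq; ring.
rewrite golden_inv psq => be1 mid strict /andP[t1 t2].
set m := phi * al - (phi - 1) * be in mid strict *.
have e : (phi + 1) * al = phi * m + be.
  have -> : phi * m + be = phi ^+ 2 * (al - be) + phi * be + be by rewrite /m; ring.
  by rewrite psq; ring.
have gap : (phi + 1) * (al + t) - (2 - phi) * (be + t) =
  phi * (m - 1) + (phi - 1) * (be - 1) + (2 * phi - 1) * (t + 1).
  by rewrite mulrDr e; ring.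
rewrite -subr_gt0 gap.
have i1 : 0 <= phi * (m - 1) by rewrite mulr_ge0; lra.
have i2 : 0 <= (phi - 1) * (be - 1) by rewrite mulr_ge0; lra.
have i3 : 0 <= (2 * phi - 1) * (t + 1) by rewrite mulr_ge0; lra.
have [mm|m1] := ltP 1 m.
  have : 0 < phi * (m - 1) by rewrite mulr_gt0; lra.
  lra.
have [bb|b1] := ltP 1 be.
  have : 0 < (phi - 1) * (be - 1) by rewrite mulr_gt0; lra.
  lra.
have m_1 : m = 1 by lra.
have be_1 : be = 1 by lra.
have : (phi + 1) * (al - 1) = 0 by rewrite mulrBr e m_1 be_1; ring.
move/eqP; rewrite mulf_eq0 subr_eq0 => /orP[] /eqP h; first by lra.
by case: strict => [|[]]; rewrite ?h ?m_1 ?be_1 ltxx.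
Qed.

(** Under the golden relation the characteristic polynomial in mu = lam^2 has
    the two roots phi^2 entry_sqr al and phi^-2 entry_sqr be: their sum is right
    because phi^2 + phi^-2 = 3, and their product because phi phi^-1 = 1.  They
    are the squared widths of axial ellipses with foci phi, - phi and phi^-1,
    - phi^-1.  Stating the result for [al] and [be] covers both forms of the
    relation, since the first and third means enter symmetrically. *)
Lemma elliptical_of_golden (b c : nat -> R[i]) (a : nat -> R) (al be : R)
    (A := tridiag b c) :
  (forall j, (j < 3)%N -> b j * c j = 1) ->
  (forall j, (j < 3)%N -> a j = (cmod (b j) ^+ 2 + cmod (c j) ^+ 2) / 2) ->
  a 0%N = al /\ a 2 = be \/ a 0%N = be /\ a 2 = al ->
  a 1%N = phi * al - phi^-1 * be ->
  1 < al \/ 1 < a 1%N \/ 1 < be ->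
  elliptical (numerical_range A) /\
  exists Eout Ein : ellipse R,
       ellipse_nondegenerate Eout /\
       nested_in Ein Eout /\
       ellipse_center Eout = 0 /\ ellipse_center Ein = 0 /\
       axis_aligned Eout /\ axis_aligned Ein /\
       kippenhahn_union A Eout Ein.
Proof.
move=> bc1 aE sym mid strict.
have ge1 := recip_mean_ge1 bc1 aE.
have a1ge := ge1 1%N isT; rewrite mid in a1ge strict.
have [al1 be1] : 1 <= al /\ 1 <= be.
  by case: sym => -[<- <-]; split; exact: ge1.
have g1 := @golden_gt1 R; have g2 := @golden_lt2 R; have psq := @golden_sqr R.
have p0 : 0 < phi by lra.
have q0 : 0 < phi^-1 by rewrite invr_gt0.
have pq : phi * phi^-1 = 1 by rewrite mulfV // gt_eqF.
have qsq : phi^-1 ^+ 2 = 2 - phi.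
  rewrite golden_inv; have -> : (phi - 1) ^+ 2 = phi ^+ 2 - 2 * phi + 1 by ring.
  by rewrite psq; ring.
have gap t := golden_factors_gap (t := t) be1 a1ge strict.
pose Aout := scaled_major phi al; pose Ain := scaled_major phi^-1 be.
have Aout0 : 0 < Aout by exact: scaled_major_gt0.
have Ain0 : 0 < Ain by exact: scaled_major_gt0.
have Fout : 0 <= phi <= Aout by exact: scaled_major_ge.
have Fin : 0 <= phi^-1 <= Ain by exact: scaled_major_ge.
have Aout2 : Aout ^+ 2 = phi ^+ 2 * ((al + 1) / 2) by exact: sqr_scaled_major.
have Ain2 : Ain ^+ 2 = phi^-1 ^+ 2 * ((be + 1) / 2) by exact: sqr_scaled_major.
pose Eout := axial_ellipse Aout0 Fout; pose Ein := axial_ellipse Ain0 Fin.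
have xsum z : entry_sqr (a 0%N) z + entry_sqr (a 1%N) z + entry_sqr (a 2) z =
    phi ^+ 2 * entry_sqr al z + phi^-1 ^+ 2 * entry_sqr be z.
  have -> : entry_sqr (a 0%N) z + entry_sqr (a 1%N) z + entry_sqr (a 2) z =
      entry_sqr al z + entry_sqr (a 1%N) z + entry_sqr be z.
    by case: sym => -[-> ->] //; ring.
  by rewrite mid qsq psq golden_inv /entry_sqr; field.
have xprod z : entry_sqr (a 0%N) z * entry_sqr (a 2) z =
    (phi ^+ 2 * entry_sqr al z) * (phi^-1 ^+ 2 * entry_sqr be z).
  transitivity ((phi * phi^-1) ^+ 2 * (entry_sqr al z * entry_sqr be z));
    last by rewrite exprMn; ring.
  rewrite pq expr1n mul1r.
  by case: sym => -[-> ->] //; ring.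
have outgt : phi < Aout.
  rewrite ltr_sqr_nneg ?(ltW p0) ?(ltW Aout0) // Aout2.
  have h := gap (-1) ltac:(lra).
  have : 0 <= phi^-1 ^+ 2 * (be + -1) by rewrite mulr_ge0 ?sqr_ge0 //; lra.
  lra.
have nd : ellipse_nondegenerate Eout by apply/axial_nondegenerate.
split.
  exists Eout => //; apply: numerical_range_axial => // z z0.
  rewrite width2_scaled_major //.
  apply: (tridiag_support bc1 aE); rewrite xsum ?xprod; first by ring.
  have n0 : 0 < Re z ^+ 2 + Im z ^+ 2.
    rewrite lt_def addr_ge0 ?sqr_ge0 // andbT.
    by move: z0; rewrite eq_complex paddr_eq0 ?sqr_ge0 // !sqrf_eq0.
  have entry_sqrE (s : R) : entry_sqr s z = (Re z ^+ 2 + Im z ^+ 2) / 2 *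
     (s + (Re z ^+ 2 - Im z ^+ 2) / (Re z ^+ 2 + Im z ^+ 2)).
    by rewrite /entry_sqr; field; exact: lt0r_neq0.
  rewrite !entry_sqrE; set t := ((_ - _) / _).
  have t1 : -1 <= t <= 1.
    have := sqr_ge0 (Re z); have := sqr_ge0 (Im z) => i0 r0.
    by rewrite /t ler_pdivlMr // ler_pdivrMr //; apply/andP; split; lra.
  have n20 : 0 < (Re z ^+ 2 + Im z ^+ 2) / 2 by rewrite divr_gt0.
  have := gap t t1; rewrite -(ltr_pM2l n20); lra.
have entry_sqr_expi (s t : R) : entry_sqr s (expi t) = (s + 1) / 2 - sin t ^+ 2.
  by rewrite /entry_sqr /= cos2sin2; field.
have out_sin t : phi ^+ 2 * entry_sqr al (expi t) = Aout ^+ 2 - phi ^+ 2 * sin t ^+ 2.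
  by rewrite entry_sqr_expi Aout2; ring.
have in_sin t : phi^-1 ^+ 2 * entry_sqr be (expi t) = Ain ^+ 2 - phi^-1 ^+ 2 * sin t ^+ 2.
  by rewrite entry_sqr_expi Ain2; ring.
have [gap1 gapN1] : phi^-1 ^+ 2 * (be + 1) < phi ^+ 2 * (al + 1) /\
   phi^-1 ^+ 2 * (be + -1) < phi ^+ 2 * (al + -1) by split; apply: gap; lra.
exists Eout, Ein; split=> //; split.
  apply: axial_nested => //; last by rewrite Aout2 Ain2; lra.
  by rewrite ltr_sqr_nneg ?(ltW Ain0) ?(ltW Aout0) // Aout2 Ain2; lra.
rewrite !axial_center; do 2 split=> //.
do 2 (split; first exact: axial_axis_aligned).
apply: kippenhahn_two_axial => [lam t|t].
  rewrite /NR_poly (NR_det_tridiag bc1 aE) xsum xprod out_sin in_sin !axial_factor.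
  by congr (_%:C); ring.
rewrite -out_sin -in_sin.
have entry_sqrE (s : R) : entry_sqr s (expi t) = (s + (1 - 2 * sin t ^+ 2)) / 2.
  by rewrite entry_sqr_expi; field.
have : -1 <= 1 - 2 * sin t ^+ 2 <= 1.
  have := sqr_ge0 (sin t); have := sqr_ge0 (cos t); rewrite cos2sin2; lra.
by move=> /gap; rewrite !entry_sqrE; lra.
Qed.

End Sufficiency.

Theorem theorem7 (R : realType) (A : 'M[R[i]]_4) (hA : reciprocal A) :
  let A1 := recip_mean A (inord 0) in
  let A2 := recip_mean A (inord 1) in
  let A3 := recip_mean A (inord 2) in
  let phi := golden R in
  (elliptical (numerical_range A) <->
     (A2 = phi * A1 - phi^-1 * A3 \/ A2 = phi * A3 - phi^-1 * A1)
     /\ (1 < A1 \/ 1 < A2 \/ 1 < A3))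
  /\
  (elliptical (numerical_range A) ->
     exists Eout Ein : ellipse R,
       ellipse_nondegenerate Eout /\
       nested_in Ein Eout /\
       ellipse_center Eout = 0 /\ ellipse_center Ein = 0 /\
       axis_aligned Eout /\ axis_aligned Ein /\
       kippenhahn_union A Eout Ein).
Proof.
move=> A1 A2 A3 phi.
have [b [c [AE bc1 meanE]]] := reciprocal_tridiag hA.
pose a j := recip_mean A (inord j).
have nec : elliptical (numerical_range A) ->
    (A2 = phi * A1 - phi^-1 * A3 \/ A2 = phi * A3 - phi^-1 * A1)
     /\ (1 < A1 \/ 1 < A2 \/ 1 < A3).
  by rewrite {1}AE; exact: (golden_of_elliptical (a := a) bc1 meanE).
have suf : (A2 = phi * A1 - phi^-1 * A3 \/ A2 = phi * A3 - phi^-1 * A1)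
     /\ (1 < A1 \/ 1 < A2 \/ 1 < A3) ->
  elliptical (numerical_range A) /\ exists Eout Ein : ellipse R,
       ellipse_nondegenerate Eout /\ nested_in Ein Eout /\
       ellipse_center Eout = 0 /\ ellipse_center Ein = 0 /\
       axis_aligned Eout /\ axis_aligned Ein /\ kippenhahn_union A Eout Ein.
  have el al be := @elliptical_of_golden R b c a al be bc1 meanE.
  rewrite /= -AE in el.
  move=> [[] mid strict].
    by apply: (el A1 A3) => //; left.
  apply: (el A3 A1) => //; first by right.
  by case: strict => [|[]]; auto.
split; first by split=> // /suf [].
by move=> /nec /suf [].
Qed.
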